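(* Let $L\in\mathcal{L}$ with associated power mean reversiblizations $P_p$, $p\in\mathbb{R}\cup\{\pm\infty\}$. For $p,q\in\mathbb{R}\cup\{\pm\infty\}$ with $p<q$ and for any $f\in\mathbb{R}^{\mathcal{X}}$, $$P_q\succeq P_p,\qquad \langle -P_qf,f\rangle_\pi\ge\langle -P_pf,f\rangle_\pi .$$ Equality $P_q(x,y)=P_p(x,y)$ for all $x\neq y$ (equivalently, $\langle -P_qf,f\rangle_\pi=\langle -P_pf,f\rangle_\pi$ for all $f\in\mathbb{R}^{\mathcal{X}}$) holds if and only if $L$ is reversible with respect to $\pi$, so that $P_p=L=L^*$. Consequently: (1) (Hitting times) For $\lambda>0$ and $A\subseteq\mathcal{X}$, $$\mathbb{E}_\pi(e^{-\lambda\tau_A(P_p)})\le\mathbb{E}_\pi(e^{-\lambda\tau_A(P_q)}).$$ In particular, for any $A\subseteq\mathcal{X}$, $\mathbb{E}_\pi(\tau_A(P_p))\ge\mathbb{E}_\pi(\tau_A(P_q))$. Furthermore, $t_{av}(P_p,\pi)\ge t_{av}(P_q,\pi)$. (2) (Spectral gap) $\lambda_2(P_p,\pi)\le\lambda_2(P_q,\pi)$; that is, $t_{rel}(P_p,\pi)\ge t_{rel}(P_q,\pi)$. (3) (Asymptotic variance) For $h\in\ell^2_0(\pi)=\{h:\pi(h)=0\}$, $\sigma^2(h,P_p,\pi)\ge\sigma^2(h,P_q,\pi)$.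
   Context: $\mathcal{X}$ is a finite set and $\pi$ is a fixed probability distribution on $\mathcal{X}$ with $\pi(x)>0$ for all $x$. $\mathcal{L}$ is the set of Markov infinitesimal generators on $\mathcal{X}$, i.e. $\mathcal{X}\times\mathcal{X}$ real matrices with non-negative off-diagonal entries and all row sums zero. $\mathcal{L}(\pi)\subseteq\mathcal{L}$ is the set of $\pi$-reversible generators, i.e. those $M$ with $\pi(x)M(x,y)=\pi(y)M(y,x)$ for all $x,y$. The $\pi$-dual $L_\pi$ of $L\in\mathcal{L}$ is the generator with off-diagonal entries $L_\pi(x,y)=\frac{\pi(y)}{\pi(x)}L(y,x)$, $x\neq y$, and diagonal entries such that all row sums are zero. When $L$ is $\pi$-stationary, $L_\pi=L^*$, the $\ell^2(\pi)$-adjoint of $L$. Power mean reversiblizations: for $x\neq y$, $P_p(x,y)=\left(\frac{L(x,y)^p+L_\pi(x,y)^p}{2}\right)^{1/p}$ for $p\in\mathbb{R}\setminus\{0\}$ (for $p<0$ understood by continuity as $0$ if $L(x,y)=0$ or $L_\pi(x,y)=0$), $P_0(x,y)=\sqrt{L(x,y)L_\pi(x,y)}$, $P_\infty(x,y)=\max\{L(x,y),L_\pi(x,y)\}$, $P_{-\infty}(x,y)=\min\{L(x,y),L_\pi(x,y)\}$; diagonal entries are such that all row sums are zero. Each $P_p\in\mathcal{L}(\pi)$. Peskun ordering: for $L_1,L_2\in\mathcal{L}(\pi)$, $L_1\succeq L_2$ means $L_1(x,y)\ge L_2(x,y)$ for all $x\neq y$. $\langle f,g\rangle_\pi=\sum_xf(x)g(x)\pi(x)$,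 $\pi(f)=\sum_xf(x)\pi(x)$. For $G\in\mathcal{L}(\pi)$ and $X=(X_t)_{t\ge0}$ the continuous-time chain with generator $G$: $\tau_A(G)=\inf\{t\ge0:X_t\in A\}$ ($\inf\emptyset=\infty$), $\tau_y=\tau_{\{y\}}$; $\mathbb{E}_x,\mathbb{E}_\pi$ are expectations with $X_0=x$, $X_0\sim\pi$; the average hitting time is $t_{av}(G,\pi)=\sum_{x,y}\mathbb{E}_x(\tau_y)\pi(x)\pi(y)$; the spectral gap is $\lambda_2(G,\pi)=\inf\{\langle -Gf,f\rangle_\pi: f\in\mathbb{R}^{\mathcal{X}},\pi(f)=0,\pi(f^2)=1\}$; the relaxation time is $t_{rel}(G,\pi)=1/\lambda_2(G,\pi)$; for $h$ with $\pi(h)=0$, the asymptotic variance (the limiting variance of $t^{-1/2}\int_0^th(X_s)\,ds$) is $\sigma^2(h,G,\pi)=-2\langle h,g\rangle_\pi$, where $g$ solves the Poisson equation $Gg=h$.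
   Formalization: The claim that equality P_q = P_p holds only if L is reversible is proved for q > 0, or for q ≤ 0 when L(x,y) = 0 implies L(y,x) = 0; otherwise it can fail, e.g. on two states with L(0,1) = 1, L(1,0) = 0, where P_p = 0 for all p ≤ 0. *)

(* Defs.v *)
From HB Require Import structures.
From mathcomp Require Import all_boot all_order all_algebra.
From mathcomp Require Import all_classical all_reals all_analysis.
Set Implicit Arguments.
Unset Strict Implicit.
Unset Printing Implicit Defensive.
Import Order.TTheory GRing.Theory Num.Theory.
Import numFieldNormedType.Exports.
Local Open Scope classical_set_scope.
Local Open Scope ring_scope.

(* T x T real matrices are represented by functions T -> T -> R. *)

Section Generators.
Variables (R : realType) (T : finType).
Implicit Types (pi f g h mu : T -> R) (G L M : T -> T -> R).

Definition is_distr mu := (forall x, 0 <= mu x) /\ \sum_x mu x = 1.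

Definition generator G :=
  (forall x y, x != y -> 0 <= G x y) /\ (forall x, \sum_y G x y = 0).

Definition apply_gen G f : T -> R := fun x => \sum_y G x y * f y.

Definition mean pi f : R := \sum_x f x * pi x.

Definition inner pi f g : R := \sum_x f x * g x * pi x.

Definition reversible_gen pi M :=
  generator M /\ forall x y, pi x * M x y = pi y * M y x.

(* M is the l^2(pi)-adjoint of L. *)
Definition is_adjoint pi L M :=
  forall f g, inner pi (apply_gen L f) g = inner pi f (apply_gen M g).

(* Only the off-diagonal values of [a] matter: the diagonal is chosen so that
   all row sums vanish. *)
Definition zero_row_sums (a : T -> T -> R) : T -> T -> R :=
  fun x y => if x == y then - \sum_(z | z != x) a x z else a x y.

Definition dual_gen pi L : T -> T -> R :=
  zero_row_sums (fun x y => pi y / pi x * L y x).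

(* Meant for a, b >= 0. The guard for r < 0 is the continuous extension: the
   library's [powR] has 0 `^ r = 0 for every r != 0. *)
Definition power_mean (p : \bar R) (a b : R) : R :=
  match p with
  | r%:E => if r == 0 then Num.sqrt (a * b)
            else if (r < 0) && ((a == 0) || (b == 0)) then 0
            else ((a `^ r + b `^ r) / 2) `^ (r^-1)
  | +oo%E => Num.max a b
  | -oo%E => Num.min a b
  end.

Definition power_mean_gen pi L (p : \bar R) : T -> T -> R :=
  zero_row_sums (fun x y => power_mean p (L x y) (dual_gen pi L x y)).

(* M1 dominates M2; the ordering is on pi-reversible generators. *)
Definition peskun pi M1 M2 :=
  [/\ reversible_gen pi M1, reversible_gen pi M2 &
      forall x y, x != y -> M2 x y <= M1 x y].

(* <-Gf, f>_pi *)
Definition dirichlet pi G f : R := inner pi (fun x => - apply_gen G f x) f.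

(* L allows a jump from x to y iff it allows one from y to x. If this fails, a
   power mean of order <= 0 vanishes at (x, y) although L does not; e.g. on two
   states with L(0,1) = 1 and L(1,0) = 0 all of them are zero. *)
Definition symmetric_support L :=
  forall x y, x != y -> L x y = 0 -> L y x = 0.

(* The infimum is +oo when T has a single point. *)
Definition spectral_gap pi G : \bar R :=
  ereal_inf [set (dirichlet pi G f)%:E |
             f in [set f | mean pi f = 0 /\ mean pi (fun x => f x ^+ 2) = 1]].

(* The extended-real inverse: 1 / 0 = +oo and 1 / +oo = 0. *)
Definition relaxation_time pi G : \bar R := ((spectral_gap pi G)^-1)%E.

(* -2 <h, g>_pi with g a solution of G g = h. For a reversible G the value does
   not depend on g, as ker G is orthogonal to the range of G. If there is no
   solution (G reducible, h not orthogonal to ker G), the variance of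
   t^(-1/2) int_0^t h(X_s) ds tends to +oo. *)
Definition asymptotic_variance pi G h : \bar R :=
  match pselect (exists g, forall x, apply_gen G g x = h x) with
  | left solvable => (- 2 * inner pi h (projT1 (cid solvable)))%:E
  | right _ => +oo%E
  end.

(* The (x, y) entry of exp(t G) = sum_k t^k / k! G^k. *)
Definition transition G (t : R) (x y : T) : R :=
  lim (series (fun k : nat =>
    t ^+ k / k`!%:R * iter k (apply_gen G) (fun z => (z == y)%:R) x) @ \oo).

End Generators.

(* A right-continuous continuous-time Markov chain with generator G: a process
   X_t (t >= 0) on a measurable space, with for each initial distribution mu a
   probability measure under which X starts from mu and has transition
   semigroup exp(t G). Values of the process at negative times and of [ctmc_law]
   at functions that are not distributions are irrelevant. *)
Record ctmc (R : realType) (T : finType) (G : T -> T -> R) := Ctmc {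
  ctmc_disp : measure_display;
  ctmc_space : measurableType ctmc_disp;
  ctmc_proc : R -> ctmc_space -> T;
  ctmc_law : (T -> R) -> probability ctmc_space R;
  ctmc_measurable : forall (t : R) (x : T), 0 <= t ->
    measurable [set w | ctmc_proc t w = x];
  ctmc_rcontinuous : forall (w : ctmc_space) (t : R), 0 <= t ->
    \forall s \near t^'+, ctmc_proc s w = ctmc_proc t w;
  ctmc_fdd : forall mu : T -> R, is_distr mu ->
    forall (n : nat) (t : nat -> R) (x : nat -> T),
    t 0%N = 0 -> (forall i, t i <= t i.+1) ->
    ctmc_law mu
      [set w | forall i : nat, (i <= n)%N -> ctmc_proc (t i) w = x i] =
    (mu (x 0%N) *
      \prod_(i < n) transition G (t i.+1 - t i) (x i) (x i.+1))%:E }.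

Section HittingTimes.
Variables (R : realType) (T : finType) (G : T -> T -> R) (X : ctmc G).

Definition hitting_time (A : {set T}) (w : ctmc_space X) : \bar R :=
  ereal_inf [set t%:E | t in [set t : R | 0 <= t /\ ctmc_proc t w \in A]].

(* E_mu(exp(- lam tau_A)), with exp(-oo) = 0. *)
Definition hitting_laplace (mu : T -> R) (lam : R) (A : {set T}) : \bar R :=
  (\int[ctmc_law X mu]_w expeR (- (lam%:E * hitting_time A w)))%E.

Definition mean_hitting_time (mu : T -> R) (A : {set T}) : \bar R :=
  (\int[ctmc_law X mu]_w hitting_time A w)%E.

Definition average_hitting_time (pi : T -> R) : \bar R :=
  (\sum_(x : T) \sum_(y : T)
     mean_hitting_time (fun z => (z == x)%:R) [set y]%SET *
       (pi x)%:E * (pi y)%:E)%E.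

End HittingTimes.

(* Main.v *)
Require Import Defs.
From HB Require Import structures.
From mathcomp Require Import all_boot all_order all_algebra.
From mathcomp Require Import all_classical all_reals all_analysis.
From mathcomp Require Import measurable_realfun ring lra.
Set Implicit Arguments.
Unset Strict Implicit.
Unset Printing Implicit Defensive.
Import Order.TTheory GRing.Theory Num.Theory.
Import numFieldNormedType.Exports.
Local Open Scope ring_scope.

(** Everything rests on one monotonicity: for [a, b >= 0] the power mean of
    order [p] increases with [p], strictly unless [a = b] or both means vanish
    at the boundary ([power_mean_lt], [power_mean_le]).  For positive [a, b]
    write [a = e^(l+s)] and [b = e^(l-s)]; the mean is then
    [e^(l + ln (cosh (p s)) / p)], and monotonicity of the exponent is
    Bernoulli's inequality.  Homogeneity of the mean makes
    [pi(x) P_p(x,y)] the [p]-mean of [pi(x) L(x,y)] and [pi(y) L(y,x)], hence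
    symmetric in [x] and [y]: each [P_p] is reversible and [P_q] dominates
    [P_p] off the diagonal.

    For a reversible [G] the Dirichlet form is
    [1/2 sum pi(x) G(x,y) (f(x) - f(y))^2] ([flow_formE]), so it is monotone
    in the off-diagonal entries, and so is its infimum, the spectral gap.

    Asymptotic variances and Laplace transforms of hitting times obey the same
    variational principle ([killed_resolvent_le]): both are [<c, u>] for the
    solution of [lam u - G u = c] on a set [B], [u = 0] outside [B], and this
    number decreases when the Dirichlet form increases.  For the variance
    [lam = 0], [c = -h] and [B] is everything; a Poisson equation solvable for
    the smaller generator is solvable for the larger one, whose kernel is
    smaller ([poisson_solvable_le]).  For the hitting time [tau] of [A],
    [c = lam], [B] is the complement of [A] and
    [u(x) = 1 - E_x (e^(- lam tau))].

    That this [u] solves the equation has to be extracted from the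
    finite-dimensional laws of the process.  Observe it at the times
    [k / (n+1)] only: the probability of avoiding [A] up to step [k] is given
    by powers of the transition matrix killed on [A] ([law_grid_survive]), and
    the discrete analogue of [u] satisfies a discrete resolvent equation.  By
    right-continuity the grid approximations converge pointwise
    ([grid_defect_cvg]), dominated convergence passes to expectations, and the
    first order expansion of [exp(t G)] ([transition_rate_cvg]) turns the
    discrete equation into the continuous one ([defect_from_notin]).

    Mean hitting times are the limits of [(1 - E e^(- lam tau)) / lam] along
    [lam = 2^-m], increasing in [m] ([mean_hitting_time_cvg]); the limit is
    linear in the initial law, which reduces the average hitting time to
    chains started from [pi]. *)

(** * Monotonicity of power means *)

Section PowerMeans.
Variable R : realType.
Implicit Types (a b c s t r u v : R) (p q : \bar R).

(** Bernoulli's inequality [1 + r (x - 1) < x^r] at [x = e^u]. Dividing by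
    [e^u] leaves two tangent line bounds, for [e^((r-1)u)] and for [e^(-u)],
    whose first order terms cancel. *)
Lemma bernoulli_expR r u : 1 < r -> u != 0 ->
  1 + r * (expR u - 1) < expR (r * u).
Proof.
move=> r1 u0.
have r0 : 0 < r by lra.
have h1 : 1 + (r - 1) * u < expR ((r - 1) * u).
  by apply: expR_gt1Dx; rewrite mulf_neq0// subr_eq0 gt_eqF.
have h2 : 1 - u <= expR (- u) by have := expR_ge1Dx (- u); lra.
have e0 := expR_gt0 u.
have eN : expR u * expR (- u) = 1 by rewrite -expRD subrr expR0.
have -> : r * u = u + (r - 1) * u by lra.
rewrite expRD.
have k1 : expR u * (1 + (r - 1) * u) < expR u * expR ((r - 1) * u).
  by rewrite ltr_pM2l.
have k2 : expR u * (1 - u) <= expR u * expR (- u) by rewrite ler_pM2l.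
rewrite eN in k2.
have k3 : (r - 1) * (expR u * (1 - u)) <= (r - 1) * 1.
  by rewrite ler_pM2l // subr_gt0.
nra.
Qed.

Definition coshR t : R := (expR t + expR (- t)) / 2.

Lemma coshR_gt0 t : 0 < coshR t.
Proof. by rewrite divr_gt0 ?addr_gt0 ?expR_gt0. Qed.

Lemma coshRN t : coshR (- t) = coshR t.
Proof. by rewrite /coshR opprK addrC. Qed.

(** The logarithm of the mean of order [r] of [e^s] and [e^(-s)]. At [r = 0]
    the convention [0^-1 = 0] gives [0], the logarithm of their geometric
    mean. *)
Definition log_cosh_mean s r : R := ln (coshR (r * s)) / r.

Lemma log_cosh_meanN s r : log_cosh_mean s (- r) = - log_cosh_mean s r.
Proof. by rewrite /log_cosh_mean mulNr coshRN invrN mulrN. Qed.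

Lemma log_cosh_mean0 s : log_cosh_mean s 0 = 0.
Proof. by rewrite /log_cosh_mean invr0 mulr0. Qed.

Lemma log_cosh_mean_gt0 s r : s != 0 -> 0 < r -> 0 < log_cosh_mean s r.
Proof.
move=> s0 r0; rewrite divr_gt0// ln_gt0 // /coshR.
have rs0 : r * s != 0 by rewrite mulf_neq0 // gt_eqF.
have h1 := expR_gt1Dx rs0.
have h2 : 1 - r * s < expR (- (r * s)) by rewrite expR_gt1Dx // oppr_eq0.
lra.
Qed.

(** With [k = ln (cosh (r1 s))], the two numbers
    [e^(r1 s - k)] and [e^(- r1 s - k)] have mean [1]; adding Bernoulli's
    inequality of exponent [r2 / r1] for the two gives
    [cosh (r2 s) > e^(k r2 / r1)]. *)
Lemma log_cosh_mean_lt_pos s r1 r2 : s != 0 -> 0 < r1 -> r1 < r2 ->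
  log_cosh_mean s r1 < log_cosh_mean s r2.
Proof.
move=> s0 r10 r12.
have r20 : 0 < r2 by exact: lt_trans r12.
pose k := ln (coshR (r1 * s)).
have ek : expR k = coshR (r1 * s) by rewrite lnK // posrE coshR_gt0.
pose r := r2 / r1.
have r_gt1 : 1 < r by rewrite ltr_pdivlMr // mul1r.
have r2E : r2 = r * r1 by rewrite divfK // gt_eqF.
have rs0 : r1 * s != 0 by rewrite mulf_neq0 // gt_eqF.
pose u := r1 * s - k; pose v := - (r1 * s) - k.
have sum2 : expR u + expR v = 2.
  rewrite /u /v !expRD -mulrDl (expRN k) ek.
  rewrite /coshR invf_div mulrCA divff ?mulr1 // gt_eqF //.
  by rewrite addr_gt0 ?expR_gt0.
have weak w : 1 + r * (expR w - 1) <= expR (r * w).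
  have [->|w0] := eqVneq w 0; first by rewrite expR0 subrr !mulr0 addr0 expR0.
  exact/ltW/bernoulli_expR.
(* u and v are not both zero, as u - v = 2 r1 s. *)
have strict : 2 < expR (r * u) + expR (r * v).
  have [u0|u0] := eqVneq u 0.
    have v0 : v != 0.
      apply: contra rs0 => /eqP v0; apply/eqP.
      move: u0 v0; rewrite /u /v; lra.
    have := bernoulli_expR r_gt1 v0; have := weak u; nra.
  have := bernoulli_expR r_gt1 u0; have := weak v; nra.
have : r * k < ln (coshR (r2 * s)).
  rewrite -ltr_expR (lnK (_ : _ \is Num.pos)) ?posrE ?coshR_gt0 //.
  have e0 := expR_gt0 (r * k).
  move: strict; rewrite /u /v !mulrBr !expRD -mulrDl (expRN (r * k)).
  rewrite ltr_pdivlMr // mulrN mulrA -r2E /coshR.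
  lra.
rewrite /log_cosh_mean -/k ltr_pdivlMr //.
by have -> : k / r1 * r2 = r * k by rewrite /r -mulrA [LHS]mulrC (mulrC r1^-1).
Qed.

(** Oddness in the order reduces negative orders to positive ones. *)
Lemma log_cosh_mean_lt s r1 r2 : s != 0 -> r1 < r2 ->
  log_cosh_mean s r1 < log_cosh_mean s r2.
Proof.
move=> s0 r12.
have [r10|r10|r10] := ltgtP r1 0; last first.
- by rewrite r10 log_cosh_mean0 log_cosh_mean_gt0 // -r10.
- exact: log_cosh_mean_lt_pos.
rewrite -(opprK r1) log_cosh_meanN.
have m1 : 0 < log_cosh_mean s (- r1) by rewrite log_cosh_mean_gt0 // oppr_gt0.
have [r20|r20|r20] := ltgtP r2 0; last first.
- by rewrite r20 log_cosh_mean0 oppr_lt0.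
- have := log_cosh_mean_gt0 s0 r20; lra.
rewrite -(opprK r2) (log_cosh_meanN s (- r2)) ltrN2.
by apply: log_cosh_mean_lt_pos; rewrite ?oppr_gt0 // ltrN2.
Qed.

Lemma log_cosh_mean_lt_norm s r : s != 0 -> log_cosh_mean s r < `|s|.
Proof.
move=> s0.
suff pos w : 0 < w -> log_cosh_mean s w < `|s|.
  have [r0|r0|->] := ltgtP r 0; [|exact: pos|].
    2: by rewrite log_cosh_mean0 normr_gt0.
  rewrite -(opprK r) log_cosh_meanN.
  have /(log_cosh_mean_gt0 s0) : 0 < - r by rewrite oppr_gt0.
  have := normr_ge0 s; lra.
move=> w0; rewrite /log_cosh_mean ltr_pdivrMr // (mulrC `|s|).
rewrite -ltr_expR (lnK (_ : _ \is Num.pos)) ?posrE ?coshR_gt0 //.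
have s0' : 0 < `|s| by rewrite normr_gt0.
have -> : coshR (w * s) = coshR (w * `|s|).
  by have [//|_] := ger0P s; rewrite mulrN coshRN.
have : expR (- (w * `|s|)) < expR (w * `|s|).
  have ws0 : 0 < w * `|s| by rewrite mulr_gt0.
  by rewrite ltr_expR; lra.
rewrite /coshR; lra.
Qed.

Lemma log_cosh_mean_gt_norm s r : s != 0 -> - `|s| < log_cosh_mean s r.
Proof.
by move=> s0; rewrite -(opprK r) log_cosh_meanN ltrN2 log_cosh_mean_lt_norm.
Qed.

Lemma power_meanE r (l s : R) :
  power_mean r%:E (expR (l + s)) (expR (l - s)) = expR (l + log_cosh_mean s r).
Proof.
rewrite /power_mean; case: eqP => [->|/eqP r0].
  rewrite log_cosh_mean0 addr0 -expRD.
  have -> : l + s + (l - s) = l + l by lra.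
  by rewrite expRD -expr2 sqrtr_sqr ger0_norm ?expR_ge0.
rewrite !gt_eqF ?expR_gt0 //= andbF.
have -> : (expR (l + s) `^ r + expR (l - s) `^ r) / 2
         = expR (r * l) * coshR (r * s).
  rewrite -!expRM /coshR.
  have -> : (l + s) * r = r * l + r * s by lra.
  have -> : (l - s) * r = r * l - r * s by lra.
  by rewrite !expRD -mulrDr mulrA.
rewrite /powR mulf_eq0 (gt_eqF (expR_gt0 _)) (gt_eqF (coshR_gt0 _)) /=.
rewrite lnM ?posrE ?expR_gt0 ?coshR_gt0 // expRK mulrDr.
by rewrite mulKf // /log_cosh_mean (mulrC (ln _)).
Qed.

Lemma power_meanC p a b : power_mean p a b = power_mean p b a.
Proof.
case: p => [r||] /=; [|exact: maxC|exact: minC].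
by rewrite mulrC orbC (addrC (a `^ r)).
Qed.

Lemma power_mean_ge0 p a b : 0 <= a -> 0 <= b -> 0 <= power_mean p a b.
Proof.
move=> a0 b0; case: p => [r||] /=.
- by case: ifP => // _; case: ifP => // _; rewrite powR_ge0.
- by rewrite le_max a0.
- by rewrite le_min a0.
Qed.

Lemma power_mean_idem p a : 0 <= a -> power_mean p a a = a.
Proof.
move=> a0; case: p => [r||] /=; [|exact: maxxx|exact: minxx].
case: eqP => [_|/eqP r0]; first by rewrite -expr2 sqrtr_sqr ger0_norm.
rewrite orbb; have [->|an0] := eqVneq a 0.
  by case: ifP => // _; rewrite powR0 // addr0 mul0r powR0 // invr_eq0.
rewrite andbF (_ : (_ + _) / 2 = a `^ r); last by lra.
by rewrite -powRrM divff // powRr1.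
Qed.

(** Homogeneity is what makes the power mean generators reversible, through
    [power_mean_flow]. *)
Lemma power_meanM p c a b : 0 < c -> 0 <= a -> 0 <= b ->
  power_mean p (c * a) (c * b) = c * power_mean p a b.
Proof.
move=> c0 a0 b0; case: p => [r||] /=.
- have cn0 : c != 0 by rewrite gt_eqF.
  rewrite !mulf_eq0 (negPf cn0) /=.
  case: eqP => [_|/eqP r0].
    rewrite mulrACA -expr2 sqrtrM ?sqr_ge0 // sqrtr_sqr ger0_norm //.
    exact: ltW.
  case: (_ && _); first by rewrite [RHS]mulr0.
  rewrite (powRM r (ltW c0) a0) (powRM r (ltW c0) b0) -mulrDr -mulrA.
  rewrite powRM ?powR_ge0 //.
    by rewrite -powRrM divff // powRr1 // ltW.
  by rewrite divr_ge0 // addr_ge0 ?powR_ge0.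
- by rewrite maxr_pMr // ltW.
- by rewrite minr_pMr // ltW.
Qed.

Lemma power_mean_lt_pos p q a b : (p < q)%E -> 0 < a -> 0 < b -> a != b ->
  power_mean p a b < power_mean q a b.
Proof.
move=> pq a0 b0 ab.
pose l := (ln a + ln b) / 2; pose s := (ln a - ln b) / 2.
have aE : a = expR (l + s).
  by rewrite -[LHS]lnK ?posrE // /l /s; congr expR; lra.
have bE : b = expR (l - s).
  by rewrite -[LHS]lnK ?posrE // /l /s; congr expR; lra.
have s0 : s != 0.
  by apply: contra ab => /eqP s0; rewrite aE bE s0 subr0 addr0.
have maxE : power_mean +oo%E a b = expR (l + `|s|).
  rewrite /= aE bE; have [sp|sn] := ger0P s.
    by apply: max_l; rewrite ler_expR; lra.
  by apply: max_r; rewrite ler_expR; lra.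
have minE : power_mean -oo%E a b = expR (l - `|s|).
  rewrite /= aE bE; have [sp|sn] := ger0P s.
    by apply: min_r; rewrite ler_expR; lra.
  by rewrite opprK; apply: min_l; rewrite ler_expR; lra.
have realE r : power_mean r%:E a b = expR (l + log_cosh_mean s r).
  by rewrite aE bE power_meanE.
have sp : 0 < `|s| by rewrite normr_gt0.
case: p pq => [p||]; case: q => [q||] //; rewrite ?lte_fin => pq.
- by rewrite !realE ltr_expR ltrD2l log_cosh_mean_lt.
- by rewrite realE maxE ltr_expR ltrD2l log_cosh_mean_lt_norm.
- by rewrite realE minE ltr_expR ltrD2l log_cosh_mean_gt_norm.
- by rewrite minE maxE ltr_expR; lra.
Qed.

Lemma power_mean0_npos p b : (p <= 0)%E -> 0 <= b -> power_mean p 0 b = 0.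
Proof.
case: p => [r||] //= ; last by move=> _ b0; apply: min_l.
rewrite lee_fin => r0 b0; rewrite mul0r sqrtr0 eqxx andbT.
by case: eqP => // /eqP rn0; rewrite lt_neqAle rn0 r0.
Qed.

Lemma power_mean0_pos r b : 0 < r -> 0 < b ->
  power_mean r%:E 0 b = expR (ln b - ln 2 / r).
Proof.
move=> r0 b0 /=; rewrite gt_eqF // ltNge (ltW r0) /= powR0 ?gt_eqF // add0r.
rewrite /powR (gt_eqF b0) mulf_eq0 !gt_eqF ?expR_gt0 ?invr_gt0 //=.
rewrite ln_div ?posrE ?expR_gt0 // expRK mulrBr mulKf ?gt_eqF //.
by rewrite (mulrC r^-1).
Qed.

Lemma power_mean0_lt p q b : (p < q)%E -> (0 < q)%E -> 0 < b ->
  power_mean p 0 b < power_mean q 0 b.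
Proof.
move=> pq q0 b0.
have l2 : 0 < ln 2 :> R by rewrite ln_gt0 // ltr1n.
have yE : power_mean +oo%E 0 b = expR (ln b).
  by rewrite lnK ?posrE //=; apply: max_r; exact: ltW.
have qpos : 0 < power_mean q 0 b.
  case: q q0 {pq} => [q||]//; rewrite ?yE ?expR_gt0 // lte_fin => q0.
  by rewrite power_mean0_pos // expR_gt0.
have [p0|p0] := leP p 0%E; first by rewrite power_mean0_npos // ltW.
case: p p0 pq => [p||] //; last by case: q {q0 qpos}.
rewrite lte_fin => p0 pq; rewrite power_mean0_pos //.
case: q q0 pq {qpos} => [q||] //; rewrite ?lte_fin => q0 pq.
  rewrite power_mean0_pos // ltr_expR ltrD2l ltrN2 ltr_pM2l //.
  by rewrite ltf_pV2.
by rewrite yE ltr_expR gtrDl oppr_lt0 divr_gt0.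
Qed.

(** If one argument is zero then all means of order at most zero vanish, so
    that strictness on the boundary needs a positive order. *)
Lemma power_mean_lt p q a b : (p < q)%E -> 0 <= a -> 0 <= b -> a != b ->
  (0 < q)%E \/ (0 < a /\ 0 < b) -> power_mean p a b < power_mean q a b.
Proof.
move=> pq; rewrite !le_eqVlt => /predU1P[<-|a0] /predU1P[<-|b0] ab.
- by rewrite eqxx in ab.
- by case=> [q0|[]]; [exact: power_mean0_lt|rewrite ltxx].
- rewrite !(power_meanC _ a).
  by case=> [q0|[_]]; [exact: power_mean0_lt|rewrite ltxx].
- by move=> _; exact: power_mean_lt_pos.
Qed.

Lemma power_mean_le p q a b : (p < q)%E -> 0 <= a -> 0 <= b ->
  power_mean p a b <= power_mean q a b.
Proof.
move=> pq a0 b0; have [->|ab] := eqVneq a b; first by rewrite !power_mean_idem.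
have [q0|q0] := ltP 0%E q; first by apply/ltW/power_mean_lt => //; left.
have p0 : (p <= 0)%E by exact: le_trans (ltW pq) q0.
have [az|an] := eqVneq a 0; first by rewrite az !power_mean0_npos.
have [bz|bn] := eqVneq b 0.
  by rewrite bz !(power_meanC _ a) !power_mean0_npos.
by apply/ltW/power_mean_lt => //; right; rewrite !lt_def an a0 bn b0.
Qed.

End PowerMeans.

(** * Reversible generators and their Dirichlet forms *)

Section Generators.
Variables (R : realType) (T : finType) (pi : T -> R).
Hypothesis pi_gt0 : forall x, 0 < pi x.
Implicit Types (f g h u v : T -> R) (a G H L : T -> T -> R).

Lemma zero_row_sums_offdiag a x y : x != y -> zero_row_sums a x y = a x y.
Proof. by rewrite /zero_row_sums => /negPf->. Qed.

Lemma sum_zero_row_sums a x : \sum_y zero_row_sums a x y = 0.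
Proof.
rewrite (bigD1 x) //= {1}/zero_row_sums eqxx addrC.
rewrite (eq_bigr (a x)) ?subrr // => y yx.
by rewrite zero_row_sums_offdiag // eq_sym.
Qed.

Lemma offdiag_eq G H : (forall x, \sum_y G x y = 0) ->
  (forall x, \sum_y H x y = 0) -> (forall x y, x != y -> G x y = H x y) ->
  forall x y, G x y = H x y.
Proof.
move=> G0 H0 GH x y; have [<-|] := eqVneq x y; last exact: GH.
have : \sum_y G x y = \sum_y H x y by rewrite G0 H0.
rewrite (bigD1 x) //= [RHS](bigD1 x) //= [in RHS](eq_bigr (G x)).
  by move=> /addIr.
by move=> z zx; rewrite GH // eq_sym.
Qed.

Lemma zero_row_sums_reversible a : (forall x y, x != y -> 0 <= a x y) ->
  (forall x y, x != y -> pi x * a x y = pi y * a y x) ->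
  reversible_gen pi (zero_row_sums a).
Proof.
move=> a0 aS; split=> [|x y].
  split=> [x y xy|x]; last exact: sum_zero_row_sums.
  by rewrite zero_row_sums_offdiag // a0.
have [->//|xy] := eqVneq x y.
by rewrite !zero_row_sums_offdiag // 1?eq_sym // aS.
Qed.

Lemma dual_gen_ge0 L : generator L ->
  forall x y, x != y -> 0 <= dual_gen pi L x y.
Proof.
move=> [L0 _] x y xy; rewrite /dual_gen zero_row_sums_offdiag //.
by rewrite mulr_ge0 ?L0 1?eq_sym // divr_ge0 // ltW.
Qed.

(** The flow of the mean generator across an edge is the mean of the two
    opposite flows of [L], a quantity symmetric in the two endpoints. *)
Lemma power_mean_flow L (p : \bar R) x y : generator L -> x != y ->
  pi x * power_mean p (L x y) (dual_gen pi L x y)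
  = power_mean p (pi x * L x y) (pi y * L y x).
Proof.
move=> Lgen xy; rewrite -power_meanM ?dual_gen_ge0 //; last exact: Lgen.1.
rewrite /dual_gen zero_row_sums_offdiag //.
by rewrite -mulrA (mulrCA (pi x)) mulVKf // gt_eqF.
Qed.

Lemma power_mean_gen_reversible L p : generator L ->
  reversible_gen pi (power_mean_gen pi L p).
Proof.
move=> Lgen; apply: zero_row_sums_reversible => x y xy.
  by rewrite power_mean_ge0 ?dual_gen_ge0 //; exact: Lgen.1.
by rewrite !power_mean_flow // 1?eq_sym // power_meanC.
Qed.

Lemma power_mean_gen_le L (p q : \bar R) x y : generator L -> (p < q)%E ->
  x != y -> power_mean_gen pi L p x y <= power_mean_gen pi L q x y.
Proof.
move=> Lgen pq xy; rewrite /power_mean_gen !zero_row_sums_offdiag //.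
by rewrite power_mean_le ?dual_gen_ge0 //; exact: Lgen.1.
Qed.

Lemma reversible_dual_gen L : generator L ->
  reversible_gen pi L <-> forall x y, x != y -> dual_gen pi L x y = L x y.
Proof.
move=> Lgen; split=> [[_ Lrev] x y xy|LE].
  rewrite /dual_gen zero_row_sums_offdiag // mulrAC -Lrev mulrAC.
  by rewrite divff ?mul1r // gt_eqF.
split=> // x y; have [->//|xy] := eqVneq x y.
rewrite -(LE x y) // /dual_gen zero_row_sums_offdiag //.
by rewrite mulrA (mulrC (pi x)) divfK // gt_eqF.
Qed.

Lemma power_mean_gen_id L p : reversible_gen pi L ->
  forall x y, power_mean_gen pi L p x y = L x y.
Proof.
move=> Lrev; have Lgen := Lrev.1; apply: offdiag_eq => [x|x|x y xy].
- exact: sum_zero_row_sums.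
- exact: Lgen.2.
- rewrite /power_mean_gen zero_row_sums_offdiag //.
  by rewrite (reversible_dual_gen Lgen).1 // power_mean_idem //; exact: Lgen.1.
Qed.

(** The means of two distinct numbers differ, so [L] equals its dual. Symmetry
    of the support makes both arguments of the means positive where they
    differ. *)
Lemma power_mean_gen_eq_reversible L (p q : \bar R) :
  generator L -> (p < q)%E ->
  (0 < q)%E \/ symmetric_support L ->
  (forall x y, x != y ->
     power_mean_gen pi L q x y = power_mean_gen pi L p x y) ->
  reversible_gen pi L.
Proof.
move=> Lgen pq qL PE; apply/(reversible_dual_gen Lgen) => x y xy.
apply/eqP/negPn/negP => neq; have := PE x y xy.
rewrite /power_mean_gen !zero_row_sums_offdiag // => /esym/eqP.
apply/negP; rewrite lt_eqF //.
apply: power_mean_lt => //.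
- exact: Lgen.1.
- exact: dual_gen_ge0.
- by rewrite eq_sym.
case: qL => [|sL]; [by left|right].
rewrite !lt_def dual_gen_ge0 // Lgen.1 // !andbT.
move: neq; rewrite /dual_gen zero_row_sums_offdiag // => neq.
have yx : y != x by rewrite eq_sym.
split; apply: contra neq => /eqP.
  by move=> Lxy; rewrite Lxy (sL _ _ xy Lxy) mulr0.
move/eqP; rewrite mulf_eq0 mulf_eq0 invr_eq0 !(gt_eqF (pi_gt0 _)) /=.
move=> /eqP Lyx.
by rewrite Lyx (sL _ _ yx Lyx) mulr0.
Qed.

Lemma reversible_adjoint G : reversible_gen pi G -> is_adjoint pi G G.
Proof.
move=> [_ Grev] f g; rewrite /inner /apply_gen.
under eq_bigr do rewrite mulr_suml mulr_suml.
rewrite exchange_big /=; apply: eq_bigr => y _.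
rewrite mulr_sumr mulr_suml; apply: eq_bigr => x _.
have := Grev x y; rewrite -(mulrC (f y)) -!mulrA => e.
by congr (_ * _); rewrite (mulrC (g x)) !mulrA -(mulrC (pi x)) e; ring.
Qed.

Lemma innerN_l f g : inner pi (fun x => - f x) g = - inner pi f g.
Proof. by rewrite /inner -sumrN; apply: eq_bigr => x _; rewrite !mulNr. Qed.

(** The polarised Dirichlet form, as a sum over edges. *)
Definition flow_form G f g : R :=
  (\sum_x \sum_y pi x * G x y * (f x - f y) * (g x - g y)) / 2.

(** Vanishing row sums turn [f y] into [f y - f x]; detailed balance allows
    exchanging the endpoints, and the average of the two expressions is the
    edge sum. *)
Lemma flow_formE G f g : reversible_gen pi G ->
  - inner pi (apply_gen G f) g = flow_form G f g.
Proof.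
move=> [[_ G0] Grev].
have e1 : - inner pi (apply_gen G f) g
    = \sum_x \sum_y pi x * G x y * (f x - f y) * g x.
  rewrite -sumrN; apply: eq_bigr => x _.
  have -> : apply_gen G f x = - \sum_y G x y * (f x - f y).
    under eq_bigr do rewrite mulrBr.
    by rewrite sumrB -mulr_suml G0 mul0r sub0r opprK.
  rewrite -mulr_suml; under [in RHS]eq_bigr do rewrite -mulrA.
  by rewrite -mulr_sumr; ring.
have e2 : - inner pi (apply_gen G f) g
    = - \sum_x \sum_y pi x * G x y * (f x - f y) * g y.
  rewrite e1 exchange_big /= -sumrN; apply: eq_bigr => x _.
  by rewrite -sumrN; apply: eq_bigr => y _; rewrite Grev; ring.
apply: (canRL (mulfK _)) => //; rewrite mulr_natr mulr2n {1}e1 e2 -sumrB.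
apply: eq_bigr => x _; rewrite -sumrB; apply: eq_bigr => y _.
by rewrite [RHS]mulrBr.
Qed.

Lemma flow_formC G f g : flow_form G f g = flow_form G g f.
Proof.
by congr (_ / _); apply: eq_bigr => x _; apply: eq_bigr => y _; rewrite mulrAC.
Qed.

Lemma dirichletE G f : reversible_gen pi G ->
  dirichlet pi G f = flow_form G f f.
Proof. by move=> Grev; rewrite /dirichlet innerN_l flow_formE. Qed.

Lemma flow_term_ge0 G f x y : generator G ->
  0 <= pi x * G x y * (f x - f y) * (f x - f y).
Proof.
move=> [G0 _]; have [->|xy] := eqVneq x y; first by rewrite subrr mulr0.
by rewrite -mulrA -expr2 mulr_ge0 ?sqr_ge0 // mulr_ge0 ?G0 // ltW.
Qed.

Lemma flow_form_ge0 G f : generator G -> 0 <= flow_form G f f.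
Proof.
move=> Ggen; rewrite divr_ge0 // sumr_ge0 // => x _; rewrite sumr_ge0 // => y _.
exact: flow_term_ge0.
Qed.

Lemma flow_form_le G H f : (forall x y, x != y -> G x y <= H x y) ->
  flow_form G f f <= flow_form H f f.
Proof.
move=> GH; rewrite ler_pM2r ?invr_gt0 //.
apply: ler_sum => x _; apply: ler_sum => y _.
have [->|xy] := eqVneq x y; first by rewrite subrr !mulr0.
rewrite -!mulrA ler_pM2l // -expr2 ler_wpM2r ?sqr_ge0 //; exact: GH.
Qed.

Lemma flow_form_eq0 G v : generator G -> flow_form G v v = 0 ->
  forall x y, G x y * (v x - v y) = 0.
Proof.
move=> Ggen v0 x y; apply/eqP.
have t0 x' y' := flow_term_ge0 v x' y' Ggen.
move: v0 => /eqP; rewrite mulf_eq0 invr_eq0 (negPf (_ : 2 != 0)) // orbF.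
rewrite psumr_eq0 => [|i _]; last exact: sumr_ge0.
move=> /allP/(_ x (mem_index_enum _)); rewrite psumr_eq0 // => /allP.
move=> /(_ y (mem_index_enum _)) /=.
by rewrite !mulf_eq0 (gt_eqF (pi_gt0 x)) /= -orbA orbb.
Qed.

(** Tested on the indicator of [x], the difference of the two forms is a sum
    of nonnegative terms containing [pi(x) (H(x,y) - G(x,y))]. *)
Lemma flow_form_eq_offdiag G H : (forall x y, x != y -> G x y <= H x y) ->
  (forall f, flow_form G f f = flow_form H f f) ->
  forall x y, x != y -> H x y = G x y.
Proof.
move=> GH e x y xy.
pose f z : R := (z == x)%:R.
pose D z w := pi z * (H z w - G z w) * (f z - f w) * (f z - f w).
have D0 z w : 0 <= D z w.
  rewrite /D; have [->|ab] := eqVneq z w; first by rewrite subrr mulr0.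
  by rewrite -mulrA -expr2 mulr_ge0 ?sqr_ge0 // mulr_ge0 ?subr_ge0 ?GH // ltW.
have : \sum_z \sum_w D z w == 0.
  have -> : \sum_z \sum_w D z w = (flow_form H f f - flow_form G f f) * 2.
    rewrite mulrBl !divfK // -sumrB; apply: eq_bigr => z _.
    by rewrite -sumrB; apply: eq_bigr => w _; rewrite /D; ring.
  by rewrite e subrr mul0r.
rewrite psumr_eq0 => [|i _]; last exact: sumr_ge0.
move=> /allP/(_ x (mem_index_enum _)); rewrite psumr_eq0 // => /allP.
move=> /(_ y (mem_index_enum _)) /=.
rewrite /D /f eqxx (eq_sym y) (negPf xy) subr0 !mulr1 mulf_eq0 gt_eqF //=.
by rewrite subr_eq0 => /eqP.
Qed.

(** Let [Q_i(u,v) = lam <u,v> + E_i(u,v)] with [E_i] the Dirichlet form of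
    [G_i]. The hypotheses say that [Q_i(u_i, v) = <c, v>] for all [v]
    vanishing outside [B], hence
    [0 <= Q_1(u1 - u2, u1 - u2) = <c,u1> - 2 <c,u2> + Q_1(u2,u2)],
    and [Q_1(u2,u2) <= Q_2(u2,u2) = <c,u2>]. *)
Lemma killed_resolvent_le G1 G2 (lam : R) (c u1 u2 : T -> R) (B : pred T) :
  0 <= lam -> reversible_gen pi G1 -> reversible_gen pi G2 ->
  (forall x y, x != y -> G1 x y <= G2 x y) ->
  (forall x, B x -> lam * u1 x - apply_gen G1 u1 x = c x) ->
  (forall x, B x -> lam * u2 x - apply_gen G2 u2 x = c x) ->
  (forall x, ~~ B x -> u1 x = 0) -> (forall x, ~~ B x -> u2 x = 0) ->
  inner pi c u2 <= inner pi c u1.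
Proof.
move=> lam0 G1rev G2rev G12 e1 e2 z1 z2.
have test G u v : reversible_gen pi G ->
    (forall x, B x -> lam * u x - apply_gen G u x = c x) ->
    (forall x, ~~ B x -> v x = 0) ->
    inner pi c v = lam * inner pi u v + flow_form G u v.
  move=> Grev e z; rewrite -flow_formE // mulr_sumr -sumrN -big_split /=.
  apply: eq_bigr => x _; case: (boolP (B x)) => [/e<-|/z->]; first by ring.
  by rewrite !mulr0 !mul0r mulr0 subr0.
have e11 := test _ _ _ G1rev e1 z1.
have e12 := test _ _ _ G1rev e1 z2.
have e22 := test _ _ _ G2rev e2 z2.
have D12 := flow_form_le u2 G12.
have := flow_form_ge0 (fun x => u1 x - u2 x) G1rev.1.
have -> : flow_form G1 (fun x => u1 x - u2 x) (fun x => u1 x - u2 x)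
    = flow_form G1 u1 u1 - 2 * flow_form G1 u1 u2 + flow_form G1 u2 u2.
  have -> : 2 * flow_form G1 u1 u2 = flow_form G1 u1 u2 + flow_form G1 u2 u1.
    by rewrite (flow_formC _ u2); ring.
  rewrite -mulrDl -mulrBl -mulrDl; congr (_ / _).
  rewrite -big_split -sumrB -big_split; apply: eq_bigr => x _ /=.
  by rewrite -big_split -sumrB -big_split; apply: eq_bigr => y _ /=; ring.
have : 0 <= lam * inner pi (fun x => u1 x - u2 x) (fun x => u1 x - u2 x).
  rewrite mulr_ge0 // sumr_ge0 // => x _.
  by rewrite mulr_ge0 -?expr2 ?sqr_ge0 // ltW.
have -> : inner pi (fun x => u1 x - u2 x) (fun x => u1 x - u2 x)
    = inner pi u1 u1 - 2 * inner pi u1 u2 + inner pi u2 u2.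
  rewrite mulr_sumr -sumrB -big_split; apply: eq_bigr => x _ /=; ring.
nra.
Qed.

(** Fredholm alternative: the matrix [pi(x) G(x,y)] is symmetric, so its row
    space is the orthogonal complement of its kernel. *)
Lemma poisson_solvable G h : reversible_gen pi G ->
  (forall v, (forall x, apply_gen G v x = 0) -> inner pi h v = 0) ->
  exists g, forall x, apply_gen G g x = h x.
Proof.
move=> [_ Grev] hker; pose n := #|T|.
pose S : 'M[R]_n :=
  \matrix_(i, j) (pi (enum_val i) * G (enum_val i) (enum_val j)).
pose r : 'rV[R]_n := \row_i (pi (enum_val i) * h (enum_val i)).
have reindexT (F : T -> R) : \sum_x F x = \sum_(i < n) F (enum_val i).
  by apply: reindex; apply: onW_bij; exact: enum_val_bij.
have : (r <= S)%MS.
  rewrite submxE; move: (cokermx S) (mulmx_coker S) => K SK.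
  apply/eqP/matrixP => i0 j; rewrite !mxE.
  (* Column j of the cokernel of S, read as a function killed by G. *)
  pose v x := K (enum_rank x) j.
  transitivity (inner pi h v).
    rewrite /inner reindexT; apply: eq_bigr => i _.
    by rewrite !mxE /v enum_valK; ring.
  apply: hker => x; apply: (mulfI (lt0r_neq0 (pi_gt0 x))); rewrite mulr0.
  have /matrixP/(_ (enum_rank x) j) := SK.
  rewrite !mxE => <-; rewrite mulr_sumr reindexT; apply: eq_bigr => i _.
  by rewrite !mxE /v enum_rankK enum_valK mulrA.
case/submxP => w rE; exists (fun x => w 0 (enum_rank x)) => x.
apply: (mulfI (lt0r_neq0 (pi_gt0 x))).
(* The row combination w solves w S = r, and S is symmetric. *)
have /matrixP/(_ 0 (enum_rank x)) := rE.
rewrite !mxE enum_rankK => ->; rewrite mulr_sumr reindexT.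
by apply: eq_bigr => i _; rewrite !mxE enum_rankK enum_valK mulrA Grev mulrC.
Qed.

(** A function killed by [H] has zero energy for [H], hence for [G], so it is
    constant along the edges of [G] and orthogonal to the range of [G]. *)
Lemma poisson_solvable_le G H h : reversible_gen pi G -> reversible_gen pi H ->
  (forall x y, x != y -> G x y <= H x y) ->
  (exists g, forall x, apply_gen G g x = h x) ->
  exists g, forall x, apply_gen H g x = h x.
Proof.
move=> Grev Hrev GH [g gh]; apply: poisson_solvable => // v Hv.
have Hv0 : flow_form H v v = 0.
  by rewrite -flow_formE // /inner big1 ?oppr0 // => x _; rewrite Hv !mul0r.
have Gv0 : flow_form G v v = 0.
  apply/le_anti; rewrite flow_form_ge0 //; last exact: Grev.1.
  by rewrite andbT -Hv0 flow_form_le.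
have -> : inner pi h v = inner pi (apply_gen G g) v.
  by apply: eq_bigr => x _; rewrite gh.
apply: oppr_inj; rewrite flow_formE // oppr0 /flow_form big1 ?mul0r // => x _.
rewrite big1 // => y _; rewrite mulrAC.
by rewrite -(mulrA (pi x)) (flow_form_eq0 Grev.1 Gv0) mulr0 mul0r.
Qed.

Lemma asymptotic_variance_le G H h :
  reversible_gen pi G -> reversible_gen pi H ->
  (forall x y, x != y -> G x y <= H x y) ->
  (asymptotic_variance pi H h <= asymptotic_variance pi G h)%E.
Proof.
move=> Grev Hrev GH; rewrite /asymptotic_variance.
case: pselect => [solH|nsolH]; case: pselect => [solG|nsolG];
  rewrite ?leey ?lee_fin //.
- case: (cid solH) => u2 /= e2; case: (cid solG) => u1 /= e1.
  have := @killed_resolvent_le G H 0 (fun x => - h x) u1 u2 predT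
    (lexx 0) Grev Hrev GH.
  rewrite !innerN_l /= => le12.
  suff : - inner pi h u2 <= - inner pi h u1 by lra.
  apply: le12 => // x _; by rewrite mul0r sub0r ?e1 ?e2.
- by case: nsolH; exact: poisson_solvable_le solG.
Qed.

Lemma dirichlet_le G H f : reversible_gen pi G -> reversible_gen pi H ->
  (forall x y, x != y -> G x y <= H x y) ->
  dirichlet pi G f <= dirichlet pi H f.
Proof. by move=> Grev Hrev GH; rewrite !dirichletE // flow_form_le. Qed.

Lemma dirichlet_eq_offdiag G H : reversible_gen pi G -> reversible_gen pi H ->
  (forall x y, x != y -> G x y <= H x y) ->
  (forall x y, x != y -> H x y = G x y) <->
  (forall f, dirichlet pi H f = dirichlet pi G f).
Proof.
move=> Grev Hrev GH; split=> [HG f|HG].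
  by apply: le_anti; rewrite !dirichlet_le // => x y xy; rewrite HG.
by apply: flow_form_eq_offdiag => // f; rewrite -!dirichletE.
Qed.

Lemma spectral_gap_ge0 G : reversible_gen pi G -> (0 <= spectral_gap pi G)%E.
Proof.
move=> Grev; apply: le_ereal_inf_tmp => _ [f _ <-].
by rewrite lee_fin dirichletE // flow_form_ge0 //; exact: Grev.1.
Qed.

Lemma spectral_gap_le G H : reversible_gen pi G -> reversible_gen pi H ->
  (forall x y, x != y -> G x y <= H x y) ->
  (spectral_gap pi G <= spectral_gap pi H)%E.
Proof.
move=> Grev Hrev GH; apply: le_ereal_inf_tmp => _ [f fP <-].
apply: (@le_trans _ _ (dirichlet pi G f)%:E).
  by apply: ereal_inf_lbound; exists f.
by rewrite lee_fin dirichlet_le.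
Qed.

End Generators.

(** * First order expansion of the transition semigroup *)

Section Transition.
Variables (R : realType) (T : finType) (G : T -> T -> R).
Local Open Scope classical_set_scope.

(** Bounds the operator norm of [G] for the supremum norm. *)
Definition abs_mass : R := \sum_x \sum_y `|G x y|.

Lemma abs_mass_ge0 : 0 <= abs_mass.
Proof. by rewrite sumr_ge0 // => x _; rewrite sumr_ge0. Qed.

Lemma iter_apply_gen_le k y x :
  `|iter k (apply_gen G) (fun z => (z == y)%:R) x| <= abs_mass ^+ k.
Proof.
elim: k x => [|k IH] x /=.
  by rewrite expr0; case: (_ == _); rewrite ?normr1 ?normr0.
apply: le_trans (ler_norm_sum _ _ _) _.
apply: (@le_trans _ _ (\sum_z `|G x z| * abs_mass ^+ k)).
  by apply: ler_sum => z _; rewrite normrM ler_wpM2l.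
rewrite -mulr_suml exprS ler_wpM2r ?exprn_ge0 ?abs_mass_ge0 //.
rewrite /abs_mass [leRHS](bigD1 x) //= lerDl sumr_ge0 // => z _.
by rewrite sumr_ge0.
Qed.

(** The remainder of the exponential series after two terms carries a factor
    [t^2]. *)
Lemma transition_first_order t x y : 0 <= t <= 1 ->
  `|transition G t x y - ((x == y)%:R + t * G x y)| <= t ^+ 2 * expR abs_mass.
Proof.
move=> /andP[t0 t1].
pose a k := iter k (apply_gen G) (fun z => (z == y)%:R) x.
pose u k : R := t ^+ k / k`!%:R * a k.
have a_le k : `|a k| <= abs_mass ^+ k by exact: iter_apply_gen_le.
have m0 := abs_mass_ge0.
have fact_ge0 k : 0 <= (k`!%:R)^-1 :> R by rewrite invr_ge0.
have coeffE k : exp_coeff abs_mass k = abs_mass ^+ k / k`!%:R by [].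
have norm_uE k : `|u k| = t ^+ k / k`!%:R * `|a k|.
  by rewrite /u !normrM ger0_norm ?exprn_ge0 // ger0_norm.
have u_le k : `|u k| <= exp_coeff abs_mass k.
  rewrite norm_uE coeffE.
  rewrite mulrAC ler_wpM2r // -[leRHS]mul1r ler_pM ?exprn_ge0 //.
  exact: exprn_ile1.
have u_cvg : cvgn (series u).
  apply: normed_cvg; apply: (series_le_cvg _ _ u_le) => //=.
  - by move=> k; exact: le_trans (u_le k).
  - exact: is_cvg_series_exp_coeff.
have head n : series u n.+2 = (x == y)%:R + t * G x y + \sum_(k < n) u k.+2.
  rewrite /series /= big_mkord 2!big_ord_recl /= addrA; congr (_ + _ + _).
    by rewrite /u /a /= expr0 fact0 divr1 mul1r.
  rewrite /u /a /= expr1 (_ : 1`! = 1)%N // divr1; congr (_ * _).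
  rewrite /apply_gen (bigD1 y) //= eqxx mulr1 big1 ?addr0 // => z /negPf->.
  by rewrite mulr0.
have tail n : `|\sum_(k < n) u k.+2| <= t ^+ 2 * expR abs_mass.
  apply: le_trans (ler_norm_sum _ _ _) _.
  apply: (@le_trans _ _ (t ^+ 2 * \sum_(k < n) exp_coeff abs_mass k.+2)).
    rewrite mulr_sumr; apply: ler_sum => k _.
    rewrite norm_uE coeffE.
    rewrite [leLHS]mulrAC [leRHS]mulrA ler_wpM2r // ler_pM ?exprn_ge0 //.
    rewrite -(addn2 k) exprD -[leRHS]mul1r ler_wpM2r ?sqr_ge0 //.
    exact: exprn_ile1.
  rewrite ler_wpM2l ?sqr_ge0 //.
  apply: (@le_trans _ _ (series (exp_coeff abs_mass) n.+2)).
    rewrite /series /= big_mkord 2!big_ord_recl /= addrA lerDr.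
    by rewrite addr_ge0 // coeffE divr_ge0 // exprn_ge0.
  apply: nondecreasing_cvgn_le; last exact: is_cvg_series_exp_coeff.
  apply/nondecreasing_seqP => n'; rewrite /series /= big_nat_recr //= lerDl.
  by rewrite coeffE divr_ge0 // exprn_ge0.
have near_le : \forall n \near \oo,
    `|series u n - ((x == y)%:R + t * G x y)| <= t ^+ 2 * expR abs_mass.
  exists 2%N => // -[|[|n]] //= _.
  by rewrite head addrAC subrr add0r.
pose c := (x == y)%:R + t * G x y.
have dcvg : `|series u n - c| @[n --> \oo] --> `|limn (series u) - c|.
  by apply: cvg_norm; apply: cvgB => //; exact: cvg_cst.
rewrite -(cvg_lim _ dcvg) //; apply: limr_le => //.
by apply/cvg_ex; eexists; exact: dcvg.
Qed.

Lemma transition_rate_cvg x y :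
  (transition G n.+1%:R^-1 x y - (x == y)%:R) / n.+1%:R^-1 @[n --> \oo]
    --> G x y.
Proof.
apply/cvgrPdist_le => /= e e0.
have h0 : (fun n => n.+1%:R^-1 * expR abs_mass) @ \oo --> (0 : R).
  rewrite -[X in _ --> X](mul0r (expR abs_mass)).
  by apply: cvgMl; exact: cvg_harmonic.
move/cvgrPdist_le/(_ _ e0): h0; apply: filterS => n /=.
set d : R := n.+1%:R^-1.
have d0 : 0 < d by rewrite invr_gt0 ltr0n.
have d1 : d <= 1 by rewrite invf_le1 ?ler1n // ltr0n.
rewrite sub0r normrN ger0_norm ?mulr_ge0 ?expR_ge0 ?(ltW d0) // => h.
have := @transition_first_order d x y; rewrite (ltW d0) d1 => /(_ isT) h1.
have -> : G x y - (transition G d x y - (x == y)%:R) / d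
    = - ((transition G d x y - ((x == y)%:R + d * G x y)) / d).
  by field; exact: lt0r_neq0.
rewrite normrN normf_div (gtr0_norm d0) ler_pdivrMr //.
apply: le_trans h1 _; rewrite expr2 -mulrA mulrC ler_wpM2r //; exact: ltW.
Qed.

End Transition.

(** * Avoiding a set along a time grid *)

Section GridSurvival.
Variables (R : realType) (T : finType) (G : T -> T -> R) (X : ctmc G).
Variables (A : {set T}) (d : R).
Hypothesis d_ge0 : 0 <= d.
Local Open Scope classical_set_scope.

Definition grid_survive (k : nat) : set (ctmc_space X) :=
  [set w | forall i, (i <= k)%N -> ctmc_proc (i%:R * d) w \notin A].

(** The probability that the chain with one-step kernel [K] started at [x]
    stays outside [A] at the times [0, ..., k]. *)
Fixpoint survive_prob (K : T -> T -> R) (k : nat) (x : T) : R :=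
  if k is k'.+1 then (x \notin A)%:R * \sum_y K x y * survive_prob K k' y
  else (x \notin A)%:R.

Let grid (i : nat) : R := i%:R * d.

Let grid_ge0 i : 0 <= grid i. Proof. by rewrite mulr_ge0. Qed.

Lemma measurable_state (t : R) (P : set T) : 0 <= t ->
  measurable [set w : ctmc_space X | P (ctmc_proc t w)].
Proof.
move=> t0.
have -> : [set w : ctmc_space X | P (ctmc_proc t w)]
    = \bigcup_(y in P) [set w | ctmc_proc t w = y].
  by apply/seteqP; split=> [w Pw|w [y Py /= ->//]]; exists (ctmc_proc t w).
by apply: fin_bigcup_measurable => // y _; exact: ctmc_measurable.
Qed.

Lemma law_total_state (P : probability (ctmc_space X) R) (t : R)
    (E : set (ctmc_space X)) : 0 <= t -> measurable E ->
  P E = (\sum_y P (E `&` [set w | ctmc_proc t w = y]))%E.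
Proof.
move=> t0 mE.
have {1}-> : E =
    \bigcup_(y in [set` enum T]) (E `&` [set w | ctmc_proc t w = y]).
  apply/seteqP; split=> [w Ew|w [y _ []//]].
  by exists (ctmc_proc t w) => //=; rewrite mem_enum.
rewrite measure_fin_bigcup //.
- by rewrite -fsbig_seq ?enum_uniq // big_enum.
- by move=> y z _ _ [w [[_ <-] [_ <-]]].
- by move=> y _; apply: measurableI => //; exact: ctmc_measurable.
Qed.

(** The trajectory is prescribed up to step [k] and then avoids [A] for [m]
    more steps (step [k] included, so that the event is empty when [s k] is in
    [A]). This interpolates between the cylinders of known law and
    [grid_survive]. *)
Let prefix_survive (k m : nat) (s : nat -> T) : set (ctmc_space X) :=
  [set w | (forall i, (i <= k)%N -> ctmc_proc (grid i) w = s i) /\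
           (forall i, (k <= i <= k + m)%N -> ctmc_proc (grid i) w \notin A)].

Let measurable_prefix_survive k m s : measurable (prefix_survive k m s).
Proof.
have -> : prefix_survive k m s = \bigcap_i [set w |
    ((i <= k)%N -> ctmc_proc (grid i) w = s i) /\
    ((k <= i <= k + m)%N -> ctmc_proc (grid i) w \notin A)].
  apply/seteqP; split=> [w [h1 h2] i _ /=|w h].
    by split; [apply: h1|apply: h2].
  by split=> i; have [] := h i I.
apply: bigcapT_measurable => i.
exact: (@measurable_state (grid i) (fun y => ((i <= k)%N -> y = s i) /\
  ((k <= i <= k + m)%N -> y \notin A))).
Qed.

(** Induction on [m]: splitting on the state at step [k + 1] lengthens the
    prescribed part by one step. *)
Let prefix_survive_law (mu : T -> R) : is_distr mu -> forall m k s,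
  ctmc_law X mu (prefix_survive k m s) =
  ((mu (s 0%N) * \prod_(i < k) transition G d (s i) (s i.+1)) *
   survive_prob (transition G d) m (s k))%:E.
Proof.
move=> mu_distr; elim=> [|m IH] k s /=.
  case: (boolP (s k \in A)) => [skA|skA] /=; rewrite ?mulr0 ?mulr1.
    rewrite (_ : prefix_survive _ _ _ = set0) ?measure0 //.
    apply/seteqP; split=> // w [h1 h2].
    have := h2 k; rewrite leqnn addn0 leqnn => /(_ isT).
    by rewrite h1 // skA.
  have grid0 : grid 0 = 0 by rewrite /grid mul0r.
  have grid_le i : grid i <= grid i.+1 by rewrite ler_wpM2r // ler_nat.
  rewrite (_ : prefix_survive _ _ _ =
      [set w | forall i, (i <= k)%N -> ctmc_proc (grid i) w = s i]).
    rewrite (@ctmc_fdd _ _ _ X mu mu_distr k grid s grid0 grid_le).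
    congr (_ * _)%:E; apply: eq_bigr => i _; congr (transition G _ _ _).
    by rewrite /grid -mulrBl -natrB // subSnn mul1r.
  (* For m = 0 the second condition only says that s k is outside A. *)
  apply/seteqP; split=> [w []//|w h]; split=> // i.
  by rewrite addn0 -eqn_leq => /eqP <-; rewrite h.
case: (boolP (s k \in A)) => [skA|skA] /=; rewrite ?mul0r ?mulr0.
  rewrite (_ : prefix_survive _ _ _ = set0) ?measure0 //.
  apply/seteqP; split=> // w [h1 h2].
  have := h2 k; rewrite leqnn leq_addr => /(_ isT).
  by rewrite h1 // skA.
rewrite (@law_total_state _ (grid k.+1)) // mul1r mulr_sumr -sumEFin.
apply: eq_bigr => y _; pose s' i := if (i <= k)%N then s i else y.
rewrite (_ : _ `&` _ = prefix_survive k.+1 m s').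
  rewrite IH big_ord_recr /= /s' leqnn leq0n ltnn.
  congr (_%:E); rewrite !mulrA; congr (_ * _ * _ * _).
  by apply: eq_bigr => i _; rewrite ltn_ord (ltnW (ltn_ord i)).
apply/seteqP; split=> [w [[h1 h2] /= hy]|w [h1 h2]].
  split=> i.
    rewrite leq_eqVlt /s' => /predU1P[->|ik]; first by rewrite ltnn.
    by rewrite -ltnS ik h1.
  by rewrite addSnnS => /andP[ki im]; apply: h2; rewrite im ltnW.
split; last by rewrite /= h1 // /s' ltnn.
split=> i; first by move=> ik; rewrite h1 /s' ?ik // ltnW.
move=> /andP[]; rewrite leq_eqVlt => /predU1P[<- _|ki im].
  by rewrite h1 // /s' leqnn.
by apply: h2; rewrite ki addSnnS.
Qed.

Lemma measurable_grid_survive k : measurable (grid_survive k).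
Proof.
have -> : grid_survive k
    = \bigcap_i [set w | (i <= k)%N -> ctmc_proc (grid i) w \notin A].
  by apply/seteqP; split=> [w h i _|w h i]; [exact: h|exact: (h i I)].
apply: bigcapT_measurable => i.
exact: (@measurable_state (grid i) (fun y => (i <= k)%N -> y \notin A)).
Qed.

Lemma law_grid_survive mu k : is_distr mu ->
  ctmc_law X mu (grid_survive k) =
  (\sum_x mu x * survive_prob (transition G d) k x)%:E.
Proof.
move=> mu_distr; rewrite (@law_total_state _ (grid 0)) //; last first.
  exact: measurable_grid_survive.
rewrite -sumEFin; apply: eq_bigr => x _.
rewrite (_ : _ `&` _ = prefix_survive 0 k (fun=> x)).
  by rewrite prefix_survive_law // big_ord0 mulr1.
apply/seteqP; split=> w [h1 h2]; split.
- by move=> i; rewrite leqn0 => /eqP ->.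
- by move=> i; rewrite add0n => /h1.
- by move=> i ik; apply: h2.
- exact: h1.
Qed.

End GridSurvival.

Arguments grid_survive {R T G} X A d k.

Lemma expRN_bounds (R : realType) (a : R) : 0 <= a ->
  1 - a <= expR (- a) <= 1 - a + a ^+ 2.
Proof.
move=> a0; rewrite expR_ge1Dx /=.
have e1 := expRxMexpNx_1 a; have e0 := expR_ge0 (- a).
have k1 : expR (- a) * (1 + a) <= 1.
  by rewrite -[leRHS]e1 mulrC ler_wpM2r // expR_ge1Dx.
rewrite -(ler_pM2r (_ : 0 < 1 + a)); last lra.
apply: le_trans k1 _; have := exprn_ge0 3 a0; nra.
Qed.

(** * The Laplace transform of a hitting time *)

Section LaplaceTransform.
Variables (R : realType) (T : finType) (G : T -> T -> R) (X : ctmc G).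
Variables (A : {set T}).
Local Open Scope classical_set_scope.

Lemma hitting_time_ge0 (w : ctmc_space X) : (0 <= hitting_time A w)%E.
Proof. by apply: le_ereal_inf_tmp => _ [t [t0 _] <-]; rewrite lee_fin. Qed.

Lemma before_hitting_time (w : ctmc_space X) t : 0 <= t ->
  (t%:E < hitting_time A w)%E -> ctmc_proc t w \notin A.
Proof.
move=> t0; apply: contraTN => tA; rewrite -leNgt.
by apply: ereal_inf_lbound; exists t.
Qed.

(** Paths are right-continuous for the discrete topology, hence constant on a
    small interval after the hitting time, and the infimum is approached by
    times in that interval. *)
Lemma after_hitting_time (w : ctmc_space X) r : hitting_time A w = r%:E ->
  exists2 e, 0 < e & forall t, r <= t < r + e -> ctmc_proc t w \in A.
Proof.
move=> tauE.
have r0 : 0 <= r by rewrite -lee_fin -tauE hitting_time_ge0.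
have [e /= e0 he] := ctmc_rcontinuous w r0.
have const s : r <= s -> s < r + e -> ctmc_proc s w = ctmc_proc r w.
  rewrite le_eqVlt => /predU1P[->//|rs] se; apply: he => //=.
  by rewrite ltr0_norm ?subr_lt0 // opprB ltrBlDl.
exists e => // t /andP[rt te]; rewrite const //.
have : (hitting_time A w < (r + e)%:E)%E by rewrite tauE lte_fin ltrDl.
move=> /ereal_inf_lt[_ [s [s0 sA] <-]]; rewrite lte_fin => se.
rewrite -(const s) //.
by rewrite -lee_fin -tauE; apply: ereal_inf_lbound; exists s.
Qed.

Variable lam : R.
Hypothesis lam_gt0 : 0 < lam.

Let d (n : nat) : R := n.+1%:R^-1.
Let M (n : nat) : nat := (n.+1 * n.+1)%N.
Let z (n : nat) : R := expR (- (lam * d n)).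

Let d_gt0 n : 0 < d n. Proof. by rewrite invr_gt0 ltr0n. Qed.
Let d_ge0 n : 0 <= d n. Proof. exact: ltW. Qed.
Let z_ge0 n : 0 <= z n. Proof. exact: expR_ge0. Qed.
Let z_le1 n : z n <= 1.
Proof. by rewrite expR_le1 oppr_le0 mulr_ge0 // ltW. Qed.

Let z_exp n k : z n ^+ k = expR (- (lam * (k%:R * d n))).
Proof. by rewrite -expRM_natl mulrN mulrCA. Qed.

Let Md n : (M n)%:R * d n = n.+1%:R.
Proof. by rewrite natrM mulfK // pnatr_eq0. Qed.

Let d_cvg : d n @[n --> \oo] --> (0 : R). Proof. exact: cvg_harmonic. Qed.

Let zM_cvg : z n ^+ M n @[n --> \oo] --> (0 : R).
Proof.
have -> : (fun n => z n ^+ M n) = (fun n => expR (- lam) ^+ n.+1).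
  by apply/funext => n; rewrite z_exp Md -expRM_natl mulrN mulrC.
rewrite (cvg_shiftS (fun n => expR (- lam) ^+ n)); apply: cvg_expr.
by rewrite ger0_norm ?expR_ge0 // expR_lt1 oppr_lt0.
Qed.

(** [1 - e^(- lam tau)], equal to [1] if [A] is never hit. Unlike
    [e^(- lam tau)] it vanishes for paths starting in [A]. *)
Definition hitting_defect (w : ctmc_space X) : R :=
  1 - fine (expeR (- (lam%:E * hitting_time A w))%E).

(** By geometric summation this is [1 - z^N] for [N] the first grid index in
    [A], capped at [M]. The cap keeps the sums finite and is harmless because
    the time horizon [M d = n + 1] goes to infinity. *)
Let grid_defect (n : nat) (w : ctmc_space X) : R :=
  (1 - z n) * \sum_(k < M n) z n ^+ k * \1_(grid_survive X A (d n) k) w.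

Let geometric n N : (1 - z n) * \sum_(k < N) z n ^+ k = 1 - z n ^+ N.
Proof. by rewrite -opprB mulNr -subrX1 opprB. Qed.

Let grid_defect_bounds n w : 0 <= grid_defect n w <= 1.
Proof.
apply/andP; split.
  rewrite mulr_ge0 ?subr_ge0 // sumr_ge0 // => k _.
  by rewrite mulr_ge0 ?exprn_ge0.
apply: (@le_trans _ _ ((1 - z n) * \sum_(k < M n) z n ^+ k)).
  rewrite ler_wpM2l ?subr_ge0 // ler_sum // => k _.
  by rewrite -[leRHS]mulr1 ler_wpM2l ?exprn_ge0 // indicE lern1 leq_b1.
by rewrite geometric gerBl exprn_ge0.
Qed.

Let grid_defectE n w N : (N <= M n)%N ->
  (forall k, (k < N)%N -> ctmc_proc (k%:R * d n) w \notin A) ->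
  (N < M n -> ctmc_proc (N%:R * d n) w \in A)%N ->
  grid_defect n w = 1 - z n ^+ N.
Proof.
move=> NM out inA; rewrite -geometric /grid_defect; congr (_ * _).
rewrite (big_ord_widen _ (fun k => z n ^+ k) NM) [RHS]big_mkcond.
apply: eq_bigr => k _; rewrite indicE; case: ltnP => kN.
  rewrite mem_set ?mulr1 // => i ik; apply: out; exact: leq_ltn_trans kN.
rewrite memNset ?mulr0 // => h.
have : (N < M n)%N by exact: leq_ltn_trans (ltn_ord k).
by move=> /inA; apply/negP/h.
Qed.

(** If [tau = r] is finite then eventually the first grid point in [A] is the
    first one at or after [r], because [A] is not left before time [r + e]; so
    [r <= N d <= r + d] and the values squeeze to [1 - e^(- lam r)]. *)
Lemma grid_defect_cvg w : grid_defect n w @[n --> \oo] --> hitting_defect w.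
Proof.
rewrite /hitting_defect; have := hitting_time_ge0 w.
case tauE : (hitting_time A w) => [r||] // r0.
- rewrite lee_fin in r0.
  have [e e0 inA] := after_hitting_time tauE.
  rewrite -EFinM -EFinN /=.
  apply: (squeeze_cvgr _ (cvg_cst (1 - expR (- (lam * r))))); last first.
    have : (fun n => 1 - expR (- (lam * (r + d n)))) @ \oo -->
        1 - expR (- (lam * (r + 0))).
      apply: cvgB; first exact: cvg_cst.
      apply: continuous_cvg; first exact: continuous_expR.
      apply: cvgN; apply: cvgMr; apply: cvgD => //; exact: cvg_cst.
    by rewrite addr0; apply.
  have dsmall : \forall n \near \oo, d n < e by exact: (cvgr_lt _ d_cvg).
  near=> n.
  have dn : d n < e by near: n.
  have rn : r <= n.+1%:R.
    apply: (@le_trans _ _ n%:R); last by rewrite ler_nat.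
    by near: n; exact: nbhs_infty_ger.
  have exN : exists N, r <= N%:R * d n by exists (M n); rewrite Md.
  case: (ex_minnP exN) => N rN minN.
  have NM : (N <= M n)%N by apply: minN; rewrite Md.
  have low k : (k < N)%N -> k%:R * d n < r.
    by move=> kN; rewrite ltNge; apply/negP => /minN; rewrite leqNgt kN.
  have Nr : N%:R * d n <= r + d n.
    case: (N) low => [_|N' low]; first by rewrite mul0r addr_ge0.
    by rewrite -natr1 mulrDl mul1r lerD2r ltW // low.
  rewrite (@grid_defectE n w N) //.
  + rewrite z_exp !lerD2l !lerN2 !ler_expR !lerN2.
    by rewrite !ler_pM2l // rN Nr.
  + move=> k kN; apply: before_hitting_time; first by rewrite mulr_ge0.
    by rewrite tauE lte_fin low.
  + move=> _; apply: inA; rewrite rN /=; apply: le_lt_trans Nr _.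
    by rewrite ltrD2l.
- rewrite gt0_muley ?lte_fin //= subr0.
  have -> : grid_defect ^~ w = (fun n => 1 - z n ^+ M n).
    apply/funext => n; apply: grid_defectE; rewrite ?ltnn // => k _.
    by apply: before_hitting_time; rewrite ?mulr_ge0 // tauE ltry.
  by rewrite -[X in _ --> X]subr0; apply: cvgB => //; exact: cvg_cst.
Unshelve. all: by end_near.
Qed.

Let measurable_grid_defect n : measurable_fun setT (grid_defect n).
Proof.
apply: measurable_funM => //; apply: measurable_sum => k.
apply: measurable_funM => //; apply: measurable_indic.
exact: measurable_grid_survive.
Qed.

Lemma measurable_hitting_defect : measurable_fun setT hitting_defect.
Proof.
apply: (measurable_fun_cvg measurable_grid_defect) => w _.
exact: grid_defect_cvg.
Qed.

Lemma hitting_defect_bounds w : 0 <= hitting_defect w <= 1.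
Proof.
have cvgw := @grid_defect_cvg w.
rewrite -(cvg_lim _ cvgw) //; apply/andP; split.
  apply: limr_ge; first by apply/cvg_ex; eexists; exact: cvgw.
  by apply: nearW => n; case/andP: (grid_defect_bounds n w).
apply: limr_le; first by apply/cvg_ex; eexists; exact: cvgw.
by apply: nearW => n; case/andP: (grid_defect_bounds n w).
Qed.

Lemma integrable_hitting_defect (mu : T -> R) :
  (ctmc_law X mu).-integrable setT (EFin \o hitting_defect).
Proof.
apply: (@le_integrable _ _ _ _ _ _ _ (EFin \o cst 1)) => //.
- exact/measurable_EFinP/measurable_hitting_defect.
- move=> w _ /=; rewrite lee_fin normr1 ger0_norm;
  by case/andP: (hitting_defect_bounds w).
- exact: finite_measure_integrable_cst.
Qed.

Lemma hitting_laplace_defect (mu : T -> R) :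
  (hitting_laplace X mu lam A =
   1 - \int[ctmc_law X mu]_w (hitting_defect w)%:E)%E.
Proof.
have one : (\int[ctmc_law X mu]_w (cst 1%E w) = 1)%E.
  by rewrite integral_cst // mul1e; exact: probability_setT.
rewrite -[X in (_ = X - _)%E]one.
rewrite -integralB //; last 2 first.
- exact: finite_measure_integrable_cst.
- exact: integrable_hitting_defect.
apply: eq_integral => w _ /=.
rewrite /hitting_defect -EFinB subKr fineK //.
have := hitting_time_ge0 w.
case: (hitting_time A w) => [r||] // _.
by rewrite gt0_muley ?lte_fin.
Qed.

(** The expectation of [grid_defect] from [x]. *)
Let grid_solution n (x : T) : R :=
  (1 - z n) * \sum_(k < M n) z n ^+ k * survive_prob A (transition G (d n)) k x.

Let integral_grid_defect n mu : is_distr mu ->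
  (\int[ctmc_law X mu]_w (grid_defect n w)%:E)%E
  = (\sum_x mu x * grid_solution n x)%:E.
Proof.
move=> mu_distr; rewrite /grid_defect.
have mS k := measurable_grid_survive X A (d_ge0 n) k.
under eq_integral do rewrite EFinM -sumEFin.
rewrite ge0_integralZl //=; last 3 first.
- apply: emeasurable_sum => k; apply/measurable_EFinP.
  by apply: measurable_funM => //; exact: measurable_indic.
- by move=> w _; apply: sume_ge0 => k _; rewrite lee_fin mulr_ge0 ?exprn_ge0.
- by rewrite lee_fin subr_ge0.
rewrite ge0_integral_sum //=; last 2 first.
- move=> k; apply/measurable_EFinP.
  by apply: measurable_funM => //; exact: measurable_indic.
- by move=> k w _; rewrite lee_fin mulr_ge0 ?exprn_ge0.
rewrite (eq_bigr (fun k : 'I_(M n) => (z n ^+ k *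
    \sum_x mu x * survive_prob A (transition G (d n)) k x)%:E)); last first.
  move=> k _; under eq_integral do rewrite EFinM.
  rewrite ge0_integralZl //=; last 2 first.
  - by apply/measurable_EFinP; exact: measurable_indic.
  - by rewrite lee_fin exprn_ge0.
  rewrite integral_indic // setIT EFinM; congr (_ * _)%E.
  exact: law_grid_survive.
rewrite sumEFin -EFinM; congr (_%:E).
rewrite /grid_solution.
under [in RHS]eq_bigr do rewrite mulrCA.
rewrite -mulr_sumr; congr (_ * _).
under [in RHS]eq_bigr do rewrite mulr_sumr.
rewrite [RHS]exchange_big /=; apply: eq_bigr => k _.
by rewrite mulr_sumr; apply: eq_bigr => x _; rewrite mulrCA.
Qed.

(** Dominated convergence, all the functions being bounded by one. *)
Let integral_defect_cvg mu : is_distr mu ->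
  (\sum_x mu x * grid_solution n x)%:E @[n --> \oo]
    --> (\int[ctmc_law X mu]_w (hitting_defect w)%:E)%E.
Proof.
move=> mu_distr.
have -> : (fun n => (\sum_x mu x * grid_solution n x)%:E)
    = (fun n => \int[ctmc_law X mu]_w (grid_defect n w)%:E)%E.
  by apply/funext => n; rewrite integral_grid_defect.
apply: (@dominated_cvg _ _ _ _ setT measurableT _ _ (EFin \o cst 1)) => //.
- by move=> n; apply/measurable_EFinP.
- by move=> w _; apply: cvg_EFin; [exact: nearW|exact: grid_defect_cvg].
- exact: finite_measure_integrable_cst.
- move=> n w _ /=; rewrite lee_fin ger0_norm;
  by case/andP: (grid_defect_bounds n w).
Qed.

Let dirac_distr x : is_distr (fun y : T => (y == x)%:R : R).
Proof.
split=> [y|]; first by rewrite ler0n.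
by rewrite (bigD1 x) //= eqxx big1 ?addr0 // => y /negPf->.
Qed.

Let sum_dirac x (f : T -> R) : \sum_y (y == x)%:R * f y = f x.
Proof.
rewrite (bigD1 x) //= eqxx mul1r big1 ?addr0 // => y /negPf->.
by rewrite mul0r.
Qed.

(** [1 - E_x (e^(- lam tau))]. *)
Definition defect_from (x : T) : R :=
  fine (\int[ctmc_law X (fun y => (y == x)%:R)]_w (hitting_defect w)%:E)%E.

Lemma defect_fromE x :
  (\int[ctmc_law X (fun y => (y == x)%:R)]_w (hitting_defect w)%:E)%E
  = (defect_from x)%:E.
Proof.
rewrite fineK //; apply: integrable_fin_num => //.
exact: integrable_hitting_defect.
Qed.

Let grid_solution_cvg x : grid_solution n x @[n --> \oo] --> defect_from x.
Proof.
have := integral_defect_cvg (dirac_distr x).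
under eq_fun do rewrite sum_dirac.
by rewrite defect_fromE => /fine_cvg.
Qed.

(** For each grid the expectation is linear in the initial law; linearity
    passes to the limit. The laws of the process for different initial
    distributions are only related through their finite-dimensional
    distributions. *)
Lemma integral_defect mu : is_distr mu ->
  (\int[ctmc_law X mu]_w (hitting_defect w)%:E)%E
  = (\sum_x mu x * defect_from x)%:E.
Proof.
move=> mu_distr; have h1 := integral_defect_cvg mu_distr.
have h2 : (\sum_x mu x * grid_solution n x)%:E @[n --> \oo]
    --> (\sum_x mu x * defect_from x)%:E.
  apply: cvg_EFin; first exact: nearW.
  apply: cvg_big => [|x _]; first exact: add_continuous.
  by apply: cvgMr; exact: grid_solution_cvg.
exact: cvg_unique h1 h2.
Qed.

Lemma defect_from_in x : x \in A -> defect_from x = 0.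
Proof.
move=> xA; apply: (cvg_unique _ (grid_solution_cvg (x := x))) => //.
rewrite (_ : (fun n => _) = cst 0); first exact: cvg_cst.
apply/funext => n; rewrite /grid_solution big1 ?mulr0 // => k _.
by case: (nat_of_ord k) => [|k'] /=; rewrite xA ?mul0r mulr0.
Qed.

Let survive_prob_bounds n k x :
  0 <= survive_prob A (transition G (d n)) k x <= 1.
Proof.
have := law_grid_survive X A (d_ge0 n) k (dirac_distr x).
rewrite sum_dirac => e; rewrite -!lee_fin -e measure_ge0 /=.
by apply: probability_le1; exact: measurable_grid_survive.
Qed.

Let rate_cvg : (1 - z n) / d n @[n --> \oo] --> lam.
Proof.
have h : lam * (1 - lam * d n) @[n --> \oo] --> lam.
  rewrite -[X in _ --> X]mulr1; apply: cvgMr.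
  rewrite -[X in _ --> X]subr0; apply: cvgB; first exact: cvg_cst.
  by rewrite -[X in _ --> X](mulr0 lam); apply: cvgMr.
apply: (squeeze_cvgr _ h (cvg_cst lam)); apply: nearW => n.
have a0 : 0 <= lam * d n by rewrite mulr_ge0 // ltW.
have /andP[low high] := expRN_bounds a0; rewrite -/(z n) in low high.
apply/andP; split; last by rewrite ler_pdivrMr //; lra.
rewrite ler_pdivlMr //; move: high; rewrite expr2; lra.
Qed.

(** First step analysis for the sum [S] of the discounted survival
    probabilities: [S + z^M w_M = 1 + z K S] outside [A], with [z^M w_M] the
    effect of the cap. Subtracting the diagonal part and dividing by the mesh
    gives a form with a limit. *)
Let grid_equation n x : x \notin A ->
  \sum_y z n * ((transition G (d n) x y - (x == y)%:R) / d n *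
    grid_solution n y)
  = (1 - z n) / d n * (grid_solution n x
      + z n ^+ M n * survive_prob A (transition G (d n)) (M n) x - 1).
Proof.
move=> xA; set K := transition G (d n); set w := survive_prob A K.
pose S y := \sum_(k < M n) z n ^+ k * w k y.
have w0 : w 0%N x = 1 by rewrite /w /= xA.
have wS k : w k.+1 x = \sum_y K x y * w k y by rewrite /w /= xA mul1r.
have step : S x + z n ^+ M n * w (M n) x = 1 + z n * \sum_y K x y * S y.
  transitivity (\sum_(k < (M n).+1) z n ^+ k * w k x).
    by rewrite big_ord_recr.
  rewrite big_ord_recl /= w0 expr0 mulr1; congr (_ + _).
  rewrite /S.
  under [in RHS]eq_bigr do rewrite mulr_sumr.
  rewrite exchange_big mulr_sumr; apply: eq_bigr => k _.
  rewrite wS exprS -mulrA; congr (_ * _); rewrite mulr_sumr.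
  by apply: eq_bigr => y _; rewrite mulrCA.
have sol y : grid_solution n y = (1 - z n) * S y by [].
have split_sum : \sum_y (K x y - (x == y)%:R) * S y = \sum_y K x y * S y - S x.
  under eq_bigr do rewrite mulrBl; rewrite sumrB; congr (_ - _).
  under eq_bigr do rewrite eq_sym; exact: sum_dirac.
transitivity ((1 - z n) / d n * (z n * \sum_y (K x y - (x == y)%:R) * S y)).
  rewrite !mulr_sumr; apply: eq_bigr => y _; rewrite sol; ring.
rewrite split_sum sol mulrBr -[z n * _](addrK 1) (addrC _ 1) -step.
congr (_ * _); ring.
Qed.

Lemma defect_from_notin x : x \notin A ->
  lam * defect_from x - apply_gen G defect_from x = lam.
Proof.
move=> xA.
have z_cvg : z n @[n --> \oo] --> (1 : R).
  have : expR (- (lam * d n)) @[n --> \oo] --> expR (- (lam * 0)).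
    apply: continuous_cvg; first exact: continuous_expR.
    by apply: cvgN; apply: cvgMr.
  by rewrite mulr0 oppr0 expR0.
have lhs : \sum_y z n * ((transition G (d n) x y - (x == y)%:R) / d n *
    grid_solution n y) @[n --> \oo] --> apply_gen G defect_from x.
  apply: cvg_big => [|y _]; first exact: add_continuous.
  rewrite -[X in _ --> X]mul1r; apply: cvgM => //.
  apply: cvgM; last exact: grid_solution_cvg.
  exact: transition_rate_cvg.
have rhs : (1 - z n) / d n * (grid_solution n x
      + z n ^+ M n * survive_prob A (transition G (d n)) (M n) x - 1)
    @[n --> \oo] --> lam * (defect_from x + 0 - 1).
  apply: cvgM; first exact: rate_cvg.
  apply: cvgB; last exact: cvg_cst.
  apply: cvgD; first exact: grid_solution_cvg.
  apply: (squeeze_cvgr _ (cvg_cst 0) zM_cvg); apply: nearW => n.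
  have /andP[s0 s1] := survive_prob_bounds n (M n) x.
  by rewrite mulr_ge0 ?exprn_ge0 //= -[leRHS]mulr1 ler_wpM2l ?exprn_ge0.
move: rhs; under eq_fun do rewrite -grid_equation //; move=> rhs.
have -> : apply_gen G defect_from x = lam * (defect_from x + 0 - 1).
  exact: cvg_unique lhs rhs.
by ring.
Qed.

End LaplaceTransform.

(** * Mean hitting times *)

Section MeanHittingTime.
Variables (R : realType) (T : finType) (G : T -> T -> R) (X : ctmc G).
Variables (A : {set T}).
Local Open Scope classical_set_scope.

Let lam (m : nat) : R := (2 ^+ m)^-1.

Let lam_gt0 m : 0 < lam m. Proof. by rewrite invr_gt0 exprn_gt0. Qed.

(** [(1 - e^(- lam tau)) / lam] for [lam = 2^-m]. *)
Let scaled_defect (m : nat) (w : ctmc_space X) : R :=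
  2 ^+ m * hitting_defect A (lam m) w.

Let scaled_defect_ge0 m w : 0 <= scaled_defect m w.
Proof.
rewrite mulr_ge0 ?exprn_ge0 //.
by case/andP: (hitting_defect_bounds A (lam_gt0 m) w).
Qed.

(** Halving [lam] replaces [1 - y^2] by [2 (1 - y)], where
    [y = e^(- lam tau / 2)]. *)
Let scaled_defectS m w : scaled_defect m w <= scaled_defect m.+1 w.
Proof.
rewrite /scaled_defect exprSr -mulrA ler_pM2l ?exprn_gt0 // /hitting_defect.
have := hitting_time_ge0 A w.
case: (hitting_time A w) => [r||] // _.
  rewrite -!EFinM -!EFinN /=.
  have -> : - (lam m * r) = - (lam m.+1 * r) + - (lam m.+1 * r).
    by rewrite /lam exprS invfM; field; rewrite expf_neq0.
  rewrite expRD; set y := expR _.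
  have := sqr_ge0 (1 - y); rewrite expr2; lra.
by rewrite !gt0_muley ?lte_fin //= !subr0 mulr1 ler1n.
Qed.

Let two_pow_cvg : 2 ^+ m @[m --> \oo] --> (+oo : set_system R).
Proof.
apply/cvgryPge => a; near=> m; apply: (@le_trans _ _ m%:R).
  by near: m; exact: nbhs_infty_ger.
by rewrite -natrX ler_nat ltnW // ltn_expl.
Unshelve. all: by end_near.
Qed.

Let lam_cvg : lam m @[m --> \oo] --> (0 : R).
Proof.
rewrite (_ : lam = fun m => 2^-1 ^+ m); last first.
  by apply/funext => m; rewrite /lam exprVn.
by apply: cvg_expr; rewrite ger0_norm ?invr_ge0 // invf_lt1 // ltr1n.
Qed.

Let scaled_defect_cvg w :
  (scaled_defect m w)%:E @[m --> \oo] --> hitting_time A w.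
Proof.
rewrite /scaled_defect /hitting_defect; have := hitting_time_ge0 A w.
case: (hitting_time A w) => [r||] // r0.
- rewrite lee_fin in r0; apply: cvg_EFin; first exact: nearW.
  have low : r - r ^+ 2 * lam m @[m --> \oo] --> r.
    rewrite -[X in _ --> X]subr0 -[X in _ - X](mulr0 (r ^+ 2)).
    by apply: cvgB; [exact: cvg_cst|exact: cvgMr].
  apply: (squeeze_cvgr _ low (cvg_cst r)); apply: nearW => m /=.
  have lr0 : 0 <= lam m * r by rewrite mulr_ge0 // ltW.
  have /andP[h1 h2] := expRN_bounds lr0.
  have pow_gt0 : 0 < 2 ^+ m :> R by rewrite exprn_gt0.
  have rE : r = 2 ^+ m * (lam m * r) by rewrite mulrA mulfV ?mul1r // gt_eqF.
  have -> : r - r ^+ 2 * lam m = 2 ^+ m * (lam m * r - (lam m * r) ^+ 2).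
    by rewrite /lam; field; rewrite expf_neq0.
  apply/andP; split; first by rewrite ler_pM2l //; lra.
  by rewrite [leRHS]rE ler_pM2l //; lra.
- apply/cvgeryP; under eq_fun do rewrite gt0_muley ?lte_fin //= subr0 mulr1.
  exact: two_pow_cvg.
Qed.

Lemma mean_hitting_time_cvg mu :
  ((2 ^+ m)%:E * \int[ctmc_law X mu]_w (hitting_defect A (lam m) w)%:E)%E
    @[m --> \oo] --> mean_hitting_time X mu A.
Proof.
have mD m := @measurable_hitting_defect _ _ _ X A _ (lam_gt0 m).
have -> : (fun m =>
    (2 ^+ m)%:E * \int[ctmc_law X mu]_w (hitting_defect A (lam m) w)%:E)%E
    = (fun m => \int[ctmc_law X mu]_w (scaled_defect m w)%:E)%E.
  apply/funext => m; rewrite -ge0_integralZl //=; last 2 first.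
  - exact/measurable_EFinP.
  - move=> w _; rewrite lee_fin.
    by case/andP: (hitting_defect_bounds A (lam_gt0 m) w).
rewrite /mean_hitting_time.
have -> : (\int[ctmc_law X mu]_w hitting_time A w)%E =
    (\int[ctmc_law X mu]_w limn (fun m => (scaled_defect m w)%:E))%E.
  apply: eq_integral => w _.
  by rewrite (cvg_lim (@ereal_hausdorff R) (@scaled_defect_cvg w)).
apply: cvg_monotone_convergence => //.
- by move=> m; apply/measurable_EFinP; apply: measurable_funM.
- by move=> m w _; rewrite lee_fin.
- move=> w _; apply/nondecreasing_seqP => m; rewrite lee_fin.
  exact: scaled_defectS.
Qed.

Lemma mean_hitting_time_ge0 mu : (0 <= mean_hitting_time X mu A)%E.
Proof. by apply: integral_ge0 => w _; exact: hitting_time_ge0. Qed.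

(** The integrals for fixed [m] are linear in [mu], and all terms are
    nonnegative, so the limits may be taken term by term. *)
Lemma mean_hitting_time_mixture mu : is_distr mu ->
  (mean_hitting_time X mu A =
   \sum_x (mu x)%:E * mean_hitting_time X (fun y => (y == x)%:R) A)%E.
Proof.
move=> mu_distr; have h1 := mean_hitting_time_cvg (mu := mu).
apply: (cvg_unique (@ereal_hausdorff R) h1).
rewrite (_ : (fun m => _) = (fun m => \sum_x (mu x)%:E * ((2 ^+ m)%:E *
    \int[ctmc_law X (fun y => (y == x)%:R)]_w
      (hitting_defect A (lam m) w)%:E))%E).
  apply: cvg_nnesum => x _.
    apply: nearW => m; rewrite mule_ge0 ?lee_fin ?mu_distr.1 //.
    rewrite mule_ge0 ?lee_fin ?exprn_ge0 // integral_ge0 // => w _.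
    by rewrite lee_fin; case/andP: (hitting_defect_bounds A (lam_gt0 m) w).
  by apply: cvgeZl => //; exact: mean_hitting_time_cvg.
apply/funext => m; rewrite (integral_defect X A (lam_gt0 m) mu_distr).
under [RHS]eq_bigr do rewrite defect_fromE // -!EFinM.
rewrite sumEFin -EFinM mulr_sumr; congr (_%:E); apply: eq_bigr => x _.
by rewrite mulrCA.
Qed.

End MeanHittingTime.

(** * Comparison of hitting times *)

Section HittingComparison.
Variables (R : realType) (T : finType) (pi : T -> R).
Hypotheses (pi_gt0 : forall x, 0 < pi x) (pi_distr : is_distr pi).
Variables (G H : T -> T -> R).
Hypotheses (Grev : reversible_gen pi G) (Hrev : reversible_gen pi H).
Hypothesis GH : forall x y, x != y -> G x y <= H x y.
Variables (X : ctmc G) (Y : ctmc H).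

Lemma integral_hitting_defect_le A lam : 0 < lam ->
  (\int[ctmc_law Y pi]_w (hitting_defect A lam w)%:E <=
   \int[ctmc_law X pi]_w (hitting_defect A lam w)%:E)%E.
Proof.
move=> lam0; rewrite !integral_defect // lee_fin -(ler_pM2l lam0) !mulr_sumr.
have := @killed_resolvent_le _ _ pi pi_gt0 G H lam (fun=> lam)
  (defect_from X A lam) (defect_from Y A lam) (fun x => x \notin A)
  (ltW lam0) Grev Hrev GH.
rewrite /inner; under eq_bigr do rewrite -mulrA (mulrC _ (pi _)).
under [X in _ <= X]eq_bigr do rewrite -mulrA (mulrC _ (pi _)).
apply.
- exact: defect_from_notin.
- exact: defect_from_notin.
- by move=> x /negbNE; exact: defect_from_in.
- by move=> x /negbNE; exact: defect_from_in.
Qed.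

Lemma hitting_laplace_le A lam : 0 < lam ->
  (hitting_laplace X pi lam A <= hitting_laplace Y pi lam A)%E.
Proof.
move=> lam0; rewrite !hitting_laplace_defect // leeB //.
exact: integral_hitting_defect_le.
Qed.

Lemma mean_hitting_time_le A :
  (mean_hitting_time Y pi A <= mean_hitting_time X pi A)%E.
Proof.
have hX := mean_hitting_time_cvg (X := X) (A := A) (mu := pi).
have hY := mean_hitting_time_cvg (X := Y) (A := A) (mu := pi).
rewrite -(cvg_lim _ hX) // -(cvg_lim _ hY) //.
apply: lee_lim; [by apply/cvg_ex; eexists; exact: hY|
  by apply/cvg_ex; eexists; exact: hX|apply: nearW => m].
rewrite lee_wpmul2l // ?lee_fin ?exprn_ge0 //.
by apply: integral_hitting_defect_le; rewrite invr_gt0 exprn_gt0.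
Qed.

Lemma average_hitting_timeE (F : T -> T -> R) (Z : ctmc F) :
  (average_hitting_time Z pi =
   \sum_y mean_hitting_time Z pi [set y]%SET * (pi y)%:E)%E.
Proof.
rewrite /average_hitting_time exchange_big /=; apply: eq_bigr => y _.
rewrite -ge0_sume_distrl; last first.
  by move=> x _; rewrite mule_ge0 ?mean_hitting_time_ge0 // lee_fin ltW.
congr (_ * _)%E; rewrite (mean_hitting_time_mixture _ _ pi_distr).
by apply: eq_bigr => x _; rewrite muleC.
Qed.

Lemma average_hitting_time_le :
  (average_hitting_time Y pi <= average_hitting_time X pi)%E.
Proof.
rewrite !average_hitting_timeE; apply: lee_sum => y _.
by rewrite lee_wpmul2r ?lee_fin ?(ltW (pi_gt0 _)) // mean_hitting_time_le.
Qed.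

End HittingComparison.

Theorem theorem3p7 (R : realType) (T : finType) (pi : T -> R)
    (pi_gt0 : forall x, 0 < pi x) (pi_distr : is_distr pi)
    (L : T -> T -> R) (L_gen : generator L)
    (p q : \bar R) (ltpq : (p < q)%E) :
  let Pp := power_mean_gen pi L p in
  let Pq := power_mean_gen pi L q in
  (peskun pi Pq Pp /\
   forall f : T -> R, dirichlet pi Pp f <= dirichlet pi Pq f) /\
  (((forall x y, x != y -> Pq x y = Pp x y) <->
     (forall f : T -> R, dirichlet pi Pq f = dirichlet pi Pp f)) /\
   ((0 < q)%E \/ symmetric_support L ->
     ((forall x y, x != y -> Pq x y = Pp x y) <-> reversible_gen pi L)) /\
   (reversible_gen pi L ->
     (forall x y, Pp x y = L x y) /\ (forall x y, Pq x y = L x y) /\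
     is_adjoint pi L L)) /\
  (forall (Xp : ctmc Pp) (Xq : ctmc Pq),
    (forall (lam : R) (A : {set T}), 0 < lam ->
      (hitting_laplace Xp pi lam A <= hitting_laplace Xq pi lam A)%E) /\
    (forall A : {set T},
      (mean_hitting_time Xq pi A <= mean_hitting_time Xp pi A)%E) /\
    (average_hitting_time Xq pi <= average_hitting_time Xp pi)%E) /\
  ((spectral_gap pi Pp <= spectral_gap pi Pq)%E /\
   (relaxation_time pi Pq <= relaxation_time pi Pp)%E) /\
  (forall h : T -> R, mean pi h = 0 ->
    (asymptotic_variance pi Pq h <= asymptotic_variance pi Pp h)%E).

Proof.
move=> Pp Pq.
have Prev : reversible_gen pi Pp by exact: power_mean_gen_reversible.
have Qrev : reversible_gen pi Pq by exact: power_mean_gen_reversible.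
have PQ x y : x != y -> Pp x y <= Pq x y by exact: power_mean_gen_le.
split; first by split=> // f; exact: dirichlet_le.
split.
  split; first exact: dirichlet_eq_offdiag.
  split=> [qL|Lrev].
    split=> [|Lrev x y _]; first exact: power_mean_gen_eq_reversible.
    by rewrite /Pp /Pq !power_mean_gen_id.
  by do 2?[split; first exact: power_mean_gen_id]; exact: reversible_adjoint.
split=> [Xp Xq|].
  split=> [lam A lam0|]; first exact: hitting_laplace_le.
  by split=> [A|]; [exact: mean_hitting_time_le|exact: average_hitting_time_le].
split; last by move=> h _; exact: asymptotic_variance_le.
have gap_le : (spectral_gap pi Pp <= spectral_gap pi Pq)%E.
  exact: spectral_gap_le.
by split=> //; rewrite /relaxation_time lee_pV2 // inE spectral_gap_ge0.
Qed.
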